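(* Let $G$ be a connected planar graph. If $\sigma_2(G)\geq 11$, then $G$ has at most one cut-edge.
   Context: All graphs are finite and simple. A cut-edge of a connected graph is an edge whose deletion increases the number of connected components. For a non-complete graph $G$, $\sigma_2(G)=\min\{\deg_G(x)+\deg_G(y) : x,y\in V(G),\ x\neq y,\ xy\notin E(G)\}$ is the minimum degree sum over pairs of distinct non-adjacent vertices; the hypothesis $\sigma_2(G)\ge 11$ presupposes that $G$ is non-complete, so that $\sigma_2(G)$ is defined. *)

(* Defs.v *)
From mathcomp Require Import all_boot all_order all_algebra.
From mathcomp Require Import all_classical reals topology normedtype.
Import Order.TTheory GRing.Theory Num.Theory numFieldNormedType.Exports.

Set Implicit Arguments.
Unset Strict Implicit.
Unset Printing Implicit Defensive.

(* A finite simple graph is a symmetric irreflexive relation e on a finite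
   type T of vertices.  An edge is a two-element set of vertices. *)
Section Graph.
Variables (T : finType) (e : rel T).

Definition edges : {set {set T}} :=
  [set E : {set T} | [exists x, exists y, e x y && (E == [set x; y]%SET)]]%SET.

Definition degree (x : T) : nat := #|[set y | e x y]%SET|.

Definition connected_graph : Prop :=
  0 < #|T| /\ forall x y : T, connect e x y.

Definition delete_edge (E : {set T}) : rel T :=
  [rel x y | e x y && ([set x; y]%SET != E)].

Definition cut_edges : {set {set T}} :=
  [set E in edges | n_comp e T < n_comp (delete_edge E) T]%SET.

Definition non_complete : Prop := exists x y : T, x != y /\ ~~ e x y.

(* The neutral value 2 * #|T| exceeds every degree sum (degrees in a simple
   graph are below #|T|), so for a non-complete graph this is the minimum;
   for a complete graph sigma2 has no meaning. *)
Definition sigma2 : nat :=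
  \big[minn/(2 * #|T|)%N]_(p : T * T | (p.1 != p.2) && ~~ e p.1 p.2)
    (degree p.1 + degree p.2)%N.

End Graph.

Section Planar.
Variable R : realType.

Local Open Scope classical_set_scope.
Local Open Scope ring_scope.

(* R * R carries the product topology, i.e. the usual topology of the plane. *)
Definition is_arc (A : set (R * R)) (a b : R * R) : Prop :=
  exists g : R -> R * R,
    [/\ {within `[0, 1], continuous g},
        {in `[0, 1] &, injective g},
        g 0 = a, g 1 = b &
        A = g @` `[0, 1]].

Definition arc_interior (A : set (R * R)) (a b : R * R) : set (R * R) :=
  A `\` [set a; b].

(* p places the vertices and A draws the edge E as the arc A E; the interior of
   an edge contains no vertex and no point of any other edge. *)
Definition plane_drawing (T : finType) (e : rel T)
    (p : T -> R * R) (A : {set T} -> set (R * R)) : Prop :=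
  [/\ injective p,
      forall x y, e x y -> is_arc (A [set x; y]%SET) (p x) (p y),
      forall x y z, e x y ->
        ~ arc_interior (A [set x; y]%SET) (p x) (p y) (p z) &
      forall x y E, e x y -> E \in edges e -> E != [set x; y]%SET ->
        arc_interior (A [set x; y]%SET) (p x) (p y) `&` A E = set0].

Definition planar (T : finType) (e : rel T) : Prop :=
  exists p A, @plane_drawing T e p A.

End Planar.

(* Main.v *)
Require Import Defs.
From mathcomp Require Import all_boot all_order all_algebra.
From mathcomp Require Import all_classical reals topology normedtype.
From mathcomp Require Import ring lra zify.
Import Order.TTheory GRing.Theory Num.Theory numFieldNormedType.Exports.

Set Implicit Arguments.
Unset Strict Implicit.
Unset Printing Implicit Defensive.

(** Two cut-edges E and F cut off two vertex sets B and C: the side of E away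
    from F and the side of F away from E.  These are disjoint and no edge joins
    them (sides_apart), so a vertex of B and a vertex of C have degree sum at
    least 11, and it is enough to find a vertex of degree at most 5 on each side.
    All edges at a side stay inside it, except for the one cut-edge.  So if all
    n vertices of a side had degree at least 6, its inner degree sum would be at
    least 6n - 1 (side_card_darts), that is, it would have at least 3n inner
    edges.  A planar graph is not that dense, and showing this is the actual
    work.

    Density gives a K5 minor: every graph with n > 0 vertices and at least
    3n - 1 edges has one (dense_K5_minor).  Edges may be deleted as long as
    there are 3n of them; afterwards some vertex v has degree at most 5.  If
    v has degree at most 3, it is deleted; if some edge vu lies in at most two
    triangles, it is contracted; in both cases one vertex and at most three
    edges are lost, and induction applies.  Otherwise the neighbourhood of v has
    four or five vertices and minimum degree at least 3, and a K5 minor can be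
    written down inside v and its neighbourhood.

    A K5 minor cannot be drawn (drawing_no_K5_minor).  Its branch sets give five
    points in the plane and, for each pair of them, a connected compact set that
    joins the pair, where the sets of two disjoint pairs are disjoint and so have
    positive distance.  A connected set can be traversed in arbitrarily small
    steps; the points visited can be moved slightly into general position.  The
    outcome is a drawing of K5 with polygonal edges in which independent edges
    do not cross (K5_chains_meet).

    Such a drawing contradicts a parity argument of van Kampen (van_kampen_K5).
    Consider the number modulo 2 of crossings between independent edges.
    Replacing one polygonal edge by the straight segment with the same ends
    changes it by the number of crossings between two closed polygons, namely
    the old edge followed by the segment, and the triangle formed by the three
    edges independent of it; this number is even.  So all edges may be taken
    straight, and then the number is odd for every five points in general
    position.  Both facts about points come down to identities between the
    orientations of the triples among five points. *)

(** * Orientations and crossings of segments *)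

Section Orientation.
Variable R : realFieldType.
Local Open Scope ring_scope.

Definition orient (a b c : R * R) : R :=
  (b.1 - a.1) * (c.2 - a.2) - (b.2 - a.2) * (c.1 - a.1).

Lemma orient_cycle a b c : orient b c a = orient a b c.
Proof. rewrite /orient; ring. Qed.

Lemma orient_swap a b c : orient b a c = - orient a b c.
Proof. rewrite /orient; ring. Qed.

Lemma orient_affine a b c d :
  orient a b c - orient a b d + orient a c d - orient b c d = 0.
Proof. rewrite /orient; ring. Qed.

Lemma orient_plucker a b c d f :
  orient a b c * orient a d f - orient a b d * orient a c f
  + orient a b f * orient a c d = 0.
Proof. rewrite /orient; ring. Qed.

End Orientation.

Section Crossings.
Variables (R : realFieldType) (I : eqType) (p : I -> R * R) (D : pred I).

Definition ccw (a b c : I) : bool := (0 < orient (p a) (p b) (p c))%R.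

(** The ends of each segment are on different sides of the line through the
    other.  For points in general position this is a transversal crossing. *)
Definition crosses (a b c d : I) : bool :=
  (ccw a b c != ccw a b d) && (ccw c d a != ccw c d b).

Definition inside (a b c d : I) : bool :=
  (ccw a b d == ccw b c d) && (ccw b c d == ccw c a d).

(** The polygonal path y :: t is crossed by a segment, and below by a path,
    either an even (false) or an odd (true) number of times; only this parity is
    stable enough to survive the changes made to the paths. *)
Fixpoint seg_crossings (a b y : I) (t : seq I) : bool :=
  if t is z :: t' then crosses a b y z (+) seg_crossings a b z t' else false.

Fixpoint path_crossings (x : I) (s : seq I) (y : I) (t : seq I) : bool :=
  if s is z :: s' then seg_crossings x z y t (+) path_crossings z s' y t
  else false.

Lemma ccw_cycle a b c : ccw b c a = ccw a b c.
Proof. by rewrite /ccw orient_cycle. Qed.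

Lemma ccw_aa a c : ccw a a c = false.
Proof. by rewrite /ccw /orient !subrr !mul0r subrr ltxx. Qed.

Lemma crosses_sym a b c d : crosses a b c d = crosses c d a b.
Proof. by rewrite /crosses andbC. Qed.

Lemma crosses_point a c d : crosses a a c d = false.
Proof. by rewrite /crosses !ccw_aa eqxx. Qed.

Hypothesis general_position : forall a b c, a \in D -> b \in D -> c \in D ->
  uniq [:: a; b; c] -> orient (p a) (p b) (p c) != 0%R.

Lemma ccw_swap a b c : all D [:: a; b; c] -> uniq [:: a; b; c] ->
  ccw b a c = ~~ ccw a b c.
Proof.
move=> /and4P[Da Db Dc _] u.
rewrite /ccw orient_swap oppr_gt0 -leNgt lt_neqAle.
by rewrite (general_position Da Db Dc u).
Qed.

(** A vanishing sum of four areas cannot have four terms of the same sign. *)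
Lemma ccw_affine a b c d :
  ~~ [&& ccw a b c, ~~ ccw a b d, ccw a c d & ~~ ccw b c d] &&
  ~~ [&& ~~ ccw a b c, ccw a b d, ~~ ccw a c d & ccw b c d].
Proof.
have := orient_affine (p a) (p b) (p c) (p d).
rewrite /ccw; set x := orient _ _ _; set y := orient _ _ _.
set z := orient _ _ _; set w := orient _ _ _ => E.
apply/andP; split; apply/negP; rewrite -!leNgt => /and4P[? ? ? ?]; lra.
Qed.

(** The three terms of the Grassmann-Pluecker relation do not vanish, and since
    their sum does, they do not all have the same sign. *)
Lemma ccw_plucker a b c d f :
  all D [:: a; b; c; d; f] -> uniq [:: a; b; c; d; f] ->
  ~~ ((ccw a b c (+) ccw a d f) == ~~ (ccw a b d (+) ccw a c f)) ||
  ~~ ((ccw a b c (+) ccw a d f) == (ccw a b f (+) ccw a c d)).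
Proof.
move=> /= /and5P[Da Db Dc Dd /andP[Df _]].
rewrite !inE !negb_or => /and5P[/and4P[ab ac ad af] /and3P[bc bd bf] /andP[cd cf] df _].
have nz x y : x \in D -> y \in D -> a != x -> a != y -> x != y ->
    orient (p a) (p x) (p y) != 0%R.
  by move=> Dx Dy ax ay xy; apply: general_position; rewrite //= !inE negb_or ax ay xy.
have := orient_plucker (p a) (p b) (p c) (p d) (p f).
move: (nz _ _ Db Dc ab ac bc) (nz _ _ Db Dd ab ad bd) (nz _ _ Db Df ab af bf)
      (nz _ _ Dc Dd ac ad cd) (nz _ _ Dc Df ac af cf) (nz _ _ Dd Df ad af df).
rewrite /ccw.
move: (orient (p a) (p b) (p c)) (orient (p a) (p b) (p d)) (orient (p a) (p b) (p f))
  (orient (p a) (p c) (p d)) (orient (p a) (p c) (p f)) (orient (p a) (p d) (p f)).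
move=> x1 x2 x3 x4 x5 x6.
case: (ltgtP 0%R x1) => // h1 _; case: (ltgtP 0%R x2) => // h2 _;
case: (ltgtP 0%R x3) => // h3 _; case: (ltgtP 0%R x4) => // h4 _;
case: (ltgtP 0%R x5) => // h5 _; case: (ltgtP 0%R x6) => // h6 _ E //=; exfalso; nra.
Qed.

(** Puts the three ways of pairing off four points in terms of the same four
    orientations, those of the triples in increasing order; this makes
    five_points a statement about ten booleans. *)
Lemma ccw_four a b c d : all D [:: a; b; c; d] -> uniq [:: a; b; c; d] ->
  [/\ crosses a b c d = (ccw a b c != ccw a b d) && (ccw a c d != ccw b c d),
      crosses a c b d = (ccw a b c == ccw a c d) && (ccw a b d == ccw b c d) &
      crosses a d b c = (ccw a b d != ccw a c d) && (ccw a b c != ccw b c d)].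
Proof.
move=> /and5P[Da Db Dc Dd _] /=.
rewrite !inE !negb_or => /and4P[/and3P[ab ac ad] /andP[bc bd] cd _].
have sw x y z : x \in D -> y \in D -> z \in D -> x != y -> x != z -> y != z ->
    ccw y x z = ~~ ccw x y z.
  by move=> Dx Dy Dz xy xz yz; apply: ccw_swap; rewrite /= ?inE ?negb_or ?xy ?xz ?yz ?Dx ?Dy ?Dz //=; apply/and4P.
have E1 : ccw a c b = ~~ ccw a b c by rewrite -ccw_cycle -(ccw_cycle a b c) sw // eq_sym.
have E2 : ccw b d c = ~~ ccw b c d by rewrite -ccw_cycle -(ccw_cycle b c d) sw // eq_sym.
have E3 : ccw a d b = ~~ ccw a b d by rewrite -ccw_cycle -(ccw_cycle a b d) sw // eq_sym.
have E4 : ccw a d c = ~~ ccw a c d by rewrite -ccw_cycle -(ccw_cycle a c d) sw // eq_sym.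
have F1 : ccw c d a = ccw a c d by rewrite ccw_cycle.
have F2 : ccw c d b = ccw b c d by rewrite ccw_cycle.
have F3 : ccw b d a = ccw a b d by rewrite ccw_cycle.
have F4 : ccw b c a = ccw a b c by rewrite ccw_cycle.
split; rewrite /crosses ?(E1, E2, E3, E4, F1, F2, F3, F4) //;
by case: (ccw a b c); case: (ccw a b d); case: (ccw a c d); case: (ccw b c d).
Qed.

(** Both parts hold for all sign patterns on the ten triples that satisfy the
    affine and the Grassmann-Pluecker constraints, which is a finite check.  The
    first says that a straight-line drawing of K5 has an odd number of
    crossings between independent edges, the second that a segment crosses the
    boundary of a triangle an odd number of times exactly if one of its ends is
    inside and the other outside. *)
Lemma five_points a b c d f :
  all D [:: a; b; c; d; f] -> uniq [:: a; b; c; d; f] ->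
  (crosses a b c d (+) crosses a b c f (+) crosses a b d f (+)
   crosses a c b d (+) crosses a c b f (+) crosses a c d f (+)
   crosses a d b c (+) crosses a d b f (+) crosses a d c f (+)
   crosses a f b c (+) crosses a f b d (+) crosses a f c d (+)
   crosses b c d f (+) crosses b d c f (+) crosses b f c d) /\
  (crosses a b d f (+) crosses b c d f (+) crosses a c d f =
   inside a b c d (+) inside a b c f).
Proof.
move=> DD U; have [Da Db Dc Dd Df] : [/\ a \in D, b \in D, c \in D, d \in D & f \in D].
  by move: DD => /= /and5P[? ? ? ? /andP[]].
have [[ab ac ad af] [bc bd bf] [cd cf] df] :
    [/\ [/\ a != b, a != c, a != d & a != f], [/\ b != c, b != d & b != f],
        c != d /\ c != f & d != f].
  move: U; rewrite /= !inE !negb_or.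
  by move=> /and5P[/and4P[? ? ? ?] /and3P[? ? ?] /andP[? ?] ? _].
have four w x y z : w \in D -> x \in D -> y \in D -> z \in D ->
    w != x -> w != y -> w != z -> x != y -> x != z -> y != z ->
    all D [:: w; x; y; z] /\ uniq [:: w; x; y; z].
  move=> Dw Dx Dy Dz wx wy wz xy xz yz; split; first by apply/and5P; split.
  by rewrite /= !inE !negb_or wx wy wz xy xz yz.
have Q w x y z Dw Dx Dy Dz wx wy wz xy xz yz :=
  let h := four w x y z Dw Dx Dy Dz wx wy wz xy xz yz in ccw_four h.1 h.2.
have [-> -> ->] := Q a b c d Da Db Dc Dd ab ac ad bc bd cd.
have [-> -> ->] := Q a b c f Da Db Dc Df ab ac af bc bf cf.
have [-> -> ->] := Q a b d f Da Db Dd Df ab ad af bd bf df.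
have [-> -> ->] := Q a c d f Da Dc Dd Df ac ad af cd cf df.
have [-> -> ->] := Q b c d f Db Dc Dd Df bc bd bf cd cf df.
have sw x y z : x \in D -> y \in D -> z \in D -> x != y -> x != z -> y != z ->
    ccw y x z = ~~ ccw x y z.
  by move=> Dx Dy Dz xy xz yz; apply: ccw_swap; rewrite /= ?inE ?negb_or ?xy ?xz ?yz //; apply/and4P.
have pl v w x y z : v \in D -> w \in D -> x \in D -> y \in D -> z \in D ->
    v != w -> v != x -> v != y -> v != z -> w != x -> w != y -> w != z ->
    x != y -> x != z -> y != z ->
  ~~ ((ccw v w x (+) ccw v y z) == ~~ (ccw v w y (+) ccw v x z)) ||
  ~~ ((ccw v w x (+) ccw v y z) == (ccw v w z (+) ccw v x y)).
  move=> Dv Dw Dx Dy Dz vw vx vy vz wx wy wz xy xz yz.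
  apply: ccw_plucker; first by rewrite /=; do 5! (apply/andP; split => //).
  by rewrite /= !inE !negb_or vw vx vy vz wx wy wz xy xz yz.
have [[ba ca da fa] [cb db fb] [dc fc] fd] :
    [/\ [/\ b != a, c != a, d != a & f != a], [/\ c != b, d != b & f != b],
        d != c /\ f != c & f != d].
  by rewrite !(eq_sym b) !(eq_sym c) !(eq_sym d) !(eq_sym f); split => //; split => //; rewrite eq_sym.
have {pl} [p1 [p2 [p3 [p4 p5]]]] := (conj (pl a b c d f Da Db Dc Dd Df ab ac ad af bc bd bf cd cf df)
  (conj (pl b a c d f Db Da Dc Dd Df ba bc bd bf ac ad af cd cf df)
  (conj (pl c a b d f Dc Da Db Dd Df ca cb cd cf ab ad af bd bf df)
  (conj (pl d a b c f Dd Da Db Dc Df da db dc df ab ac af bc bf cf)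
        (pl f a b c d Df Da Db Dc Dd fa fb fc fd ab ac ad bc bd cd))))).
move: p1 p2 p3 p4 p5.
rewrite /inside.
rewrite (sw a b c) // (sw a b d) // (sw a b f) // (sw a c d) // (sw a c f) // (sw a d f) //.
rewrite (sw b c d) // (sw b c f) // (sw b d f) // (sw c d f) //.
rewrite -(ccw_cycle c a b) -(ccw_cycle d a b) -(ccw_cycle d a c) -(ccw_cycle d b c).
rewrite -!(ccw_cycle f).
(* All orientations now have their arguments in increasing order. *)
move: (andP (ccw_affine a b c d)) (andP (ccw_affine a b c f)) (andP (ccw_affine a b d f))
  (andP (ccw_affine a c d f)) (andP (ccw_affine b c d f)).
clear.
move: (ccw a b c) (ccw a b d) (ccw a b f) (ccw a c d) (ccw a c f) (ccw a d f)
  (ccw b c d) (ccw b c f) (ccw b d f) (ccw c d f).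
by do 10! case; case; do ?[by [] | case | move=> _].
Qed.

(** * Closed polygons cross evenly *)

Lemma path_crossings_nil x s y : path_crossings x s y [::] = false.
Proof. by elim: s x => //= z s IH x; rewrite IH. Qed.

Lemma path_crossings1 x z y w :
  path_crossings x [:: z] y [:: w] = crosses x z y w.
Proof. by rewrite /= !addbF. Qed.

Lemma path_crossings_sym x s y t : path_crossings x s y t = path_crossings y t x s.
Proof.
elim: t x s y => [|z t IH] x s y /=; first by rewrite path_crossings_nil.
rewrite -IH; elim: s x => //= w s IHs x; rewrite IHs crosses_sym.
by rewrite -!addbA; congr addb; rewrite addbCA.
Qed.

Lemma seg_crossings_point a y t : seg_crossings a a y t = false.
Proof. by elim: t y => //= z t IH y; rewrite IH crosses_point. Qed.

Lemma seg_crossingsC a b y t : all D [:: a, b, y & t] ->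
  a != b -> a \notin y :: t -> b \notin y :: t ->
  seg_crossings a b y t = seg_crossings b a y t.
Proof.
move=> + ab; elim: t y => //= z t IH y /and5P[Da Db Dy Dz Dt].
rewrite !inE !negb_or => /and3P[ay az at_] /and3P[by_ bz bt].
rewrite IH /= ?Da ?Db ?Dz ?inE ?negb_or ?az ?bz //; congr addb.
rewrite /crosses [ccw _ _ b == _]eq_sym; congr (_ && _).
have sw x : x \in D -> a != x -> b != x -> ccw b a x = ~~ ccw a b x.
  move=> Dx ax bx; apply: ccw_swap; first by apply/and4P.
  by rewrite /= !inE negb_or ab ax bx.
by rewrite !sw //; case: ccw; case: ccw.
Qed.

(** Along a path that avoids the corners, each crossing of the triangle switches
    between its inside and its outside. *)
Lemma seg_crossings_triangle a x b y t : all D [:: a, x, b, y & t] ->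
  uniq [:: a; x; b] -> all (fun z => z \notin y :: t) [:: a; x; b] ->
  seg_crossings a x y t (+) seg_crossings x b y t (+) seg_crossings a b y t =
  inside a x b y (+) inside a x b (last y t).
Proof.
move=> + uaxb; elim: t y => [|z t IH] y /=; first by rewrite addbb.
move=> /and5P[Da Dx Db Dy /andP[Dz Dt]].
rewrite andbT !inE !negb_or.
move=> /and3P[/and3P[ay az at_] /and3P[xy xz xt] /and3P[by_ bz bt]].
have /= := IH z; rewrite Da Dx Db Dz Dt !inE !negb_or az xz bz at_ xt bt.
move=> /(_ isT isT) E.
have {E} -> : inside a x b y (+) inside a x b (last z t) =
   (inside a x b y (+) inside a x b z) (+)
   (seg_crossings a x z t (+) seg_crossings x b z t (+) seg_crossings a b z t).
  by rewrite E addbA addbK.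
have <- : crosses a x y z (+) crosses x b y z (+) crosses a b y z =
          inside a x b y (+) inside a x b z.
  have [->|yz] := eqVneq y z; first by rewrite /crosses !eqxx addbb.
  have DD : all D [:: a; x; b; y; z] by rewrite /=; do 5! (apply/andP; split => //).
  apply: (five_points DD _).2.
  move: uaxb; rewrite /= !inE !negb_or => /and3P[/andP[-> ->] -> _].
  by rewrite ay az xy xz by_ bz yz.
by case: (crosses a x y z); case: (crosses x b y z); case: (crosses a b y z);
  case: seg_crossings; case: seg_crossings; case: seg_crossings.
Qed.

(** The paths K from k to l, L from l to m and M from k to m form a closed
    polygon; M runs against its direction, which does not affect parities. *)
Definition cycle_crossings (a b k l : I) (K L M : seq I) : bool :=
  seg_crossings a b k K (+) seg_crossings a b l L (+) seg_crossings a b k M.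

(** By seg_crossings_triangle the sides of a triangle a x b are together crossed
    by K, L and M as often as their end points alternate between inside and
    outside, and each of k, l and m is an end point twice. *)
Lemma cycle_crossings_triangle a x b k K L M :
  last k M = last k (K ++ L) ->
  all D [:: a; x; b] -> all D (k :: K ++ L ++ M) ->
  all (fun z => z \notin k :: K ++ L ++ M) [:: a; x; b] ->
  let C u v := cycle_crossings u v k (last k K) K L M in
  C a x (+) C x b = C a b.
Proof.
move=> ends Daxb Dk; rewrite /= andbT => /and3P[ak xk bk].
have sub y t : y \in k :: K ++ L ++ M -> {subset t <= k :: K ++ L ++ M} ->
    all D (y :: t) /\ forall z, z \notin k :: K ++ L ++ M -> z \notin y :: t.
  move=> yk tk; have h : {subset y :: t <= k :: K ++ L ++ M}.
    by move=> z; rewrite inE => /orP[/eqP->|/tk].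
  by split=> [|z]; [apply/allP => z /h; apply: (allP Dk) | apply: contra => /h].
have [] := sub k K; rewrite ?mem_head //.
  by move=> z zK; rewrite inE mem_cat zK orbT.
have [] := sub (last k K) L.
- by rewrite -cat_cons mem_cat mem_last.
- by move=> z zK; rewrite inE !mem_cat zK !orbT.
have [] := sub k M; rewrite ?mem_head //.
  by move=> z zK; rewrite inE !mem_cat zK !orbT.
move=> DM nM DL nL DK nK.
rewrite /cycle_crossings; have [->|ax] := eqVneq a x.
  by rewrite !seg_crossings_point.
have [->|xb] := eqVneq x b.
  by rewrite !seg_crossings_point /= addbF.
move: Daxb => /= /and4P[Da Dx Db _].
(* Here the path goes from a to x and straight back. *)
have [ab|ab] := eqVneq a b.
  rewrite -ab !seg_crossings_point /=.
  rewrite (seg_crossingsC _ ax) ?nK //; last by rewrite /= Da Dx.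
  rewrite (seg_crossingsC _ ax) ?nL //; last by rewrite /= Da Dx.
  rewrite (seg_crossingsC _ ax) ?nM //; last by rewrite /= Da Dx.
  exact: addbb.
have uaxb : uniq [:: a; x; b] by rewrite /= !inE negb_or ax ab xb.
have T y t : all D (y :: t) -> (forall z, z \notin k :: K ++ L ++ M -> z \notin y :: t) ->
  seg_crossings a x y t (+) seg_crossings x b y t (+) seg_crossings a b y t =
  inside a x b y (+) inside a x b (last y t).
  move=> Dy ny; apply: seg_crossings_triangle => //.
    by rewrite [all _ _]/= Da Dx Db.
  by rewrite /= !ny.
move: (T _ _ DK nK) (T _ _ DL nL) (T _ _ DM nM); rewrite ends last_cat.
do 3 case: inside; do 9 case: seg_crossings => //.
Qed.

(** A polygonal path is shortened to a segment by repeatedly replacing its first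
    two segments by one, that is, by adding a triangle. *)
Lemma cycle_crossings_straighten a s k K L M :
  last k M = last k (K ++ L) ->
  all D (a :: s) -> all D (k :: K ++ L ++ M) ->
  all (fun z => z \notin k :: K ++ L ++ M) (a :: s) ->
  path_crossings a s k K (+) path_crossings a s (last k K) L
    (+) path_crossings a s k M =
  let t := [:: last a s] in
  path_crossings a t k K (+) path_crossings a t (last k K) L
    (+) path_crossings a t k M.
Proof.
move=> ends + Dk; rewrite /= !addbF -/(cycle_crossings _ _ _ _ _ _ _).
elim: s a => [|x s IH] a /=.
  by rewrite /cycle_crossings !seg_crossings_point.
move=> /and3P[Da Dx Ds]; move=> /and3P[ak xk sk].
have Dl : last x s \in D by have := mem_last x s; apply: (allP (_ : all D (x :: s))); apply/andP.
have nl : last x s \notin k :: K ++ L ++ M.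
  have := mem_last x s; apply: (allP (_ : all (fun z => z \notin k :: K ++ L ++ M) (x :: s))).
  by rewrite /= xk.
have h1 : all D [:: a; x; last x s] by rewrite /= Da Dx andbT; exact: Dl.
have h2 : all (fun z => z \notin k :: K ++ L ++ M) [:: a; x; last x s].
  by rewrite /= ak xk nl.
have /= <- := cycle_crossings_triangle ends h1 Dk h2.
rewrite -IH; [|by rewrite /= Dx|by rewrite /= xk].
rewrite /cycle_crossings.
by do 3 case: (seg_crossings a x _ _); do 3 case: (path_crossings x s _ _).
Qed.
End Crossings.

(** * The parity argument of van Kampen *)

Section Exchange.
(* X b i j b' k l stands for the crossing parity of the edges ij and kl of K5,
   and b, b' say whether these edges have been straightened. *)
Variable X : bool -> nat -> nat -> bool -> nat -> nat -> bool.
Hypothesis X_sym : forall b i j b' k l, X b i j b' k l = X b' k l b i j.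
Hypothesis step : forall i j k l m b1 b2 b3,
  i < j < 5 -> [&& k < l, l < m & m < 5] -> uniq [:: i; j; k; l; m] ->
  X false i j b1 k l (+) X false i j b2 l m (+) X false i j b3 k m =
  X true i j b1 k l (+) X true i j b2 l m (+) X true i j b3 k m.

(** The crossing parity over the fifteen pairs of independent edges of K5, the
    flag of each edge saying whether it has been straightened. *)
Definition independent_parity f01 f02 f03 f04 f12 f13 f14 f23 f24 f34 :=
  X f01 0 1 f23 2 3 (+) X f01 0 1 f24 2 4 (+) X f01 0 1 f34 3 4 (+)
  X f02 0 2 f13 1 3 (+) X f02 0 2 f14 1 4 (+) X f02 0 2 f34 3 4 (+)
  X f03 0 3 f12 1 2 (+) X f03 0 3 f14 1 4 (+) X f03 0 3 f24 2 4 (+)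
  X f04 0 4 f12 1 2 (+) X f04 0 4 f13 1 3 (+) X f04 0 4 f23 2 3 (+)
  X f12 1 2 f34 3 4 (+) X f13 1 3 f24 2 4 (+) X f14 1 4 f23 2 3.

Let addb_cancel (u v x y : bool) :
  u = v -> (x - u = y - v :> bool)%R -> x = y.
Proof. by move=> -> /addIr. Qed.

(* Moves all terms to one side and lets ring work in the two-element field. *)
Ltac swap_step E := apply: (addb_cancel E);
  rewrite /independent_parity
    ?(X_sym _ 2 3 _ 0 1) ?(X_sym _ 2 4 _ 0 1) ?(X_sym _ 3 4 _ 0 1)
    ?(X_sym _ 1 3 _ 0 2) ?(X_sym _ 1 4 _ 0 2) ?(X_sym _ 3 4 _ 0 2)
    ?(X_sym _ 1 2 _ 0 3) ?(X_sym _ 1 4 _ 0 3) ?(X_sym _ 2 4 _ 0 3)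
    ?(X_sym _ 1 2 _ 0 4) ?(X_sym _ 1 3 _ 0 4) ?(X_sym _ 2 3 _ 0 4)
    ?(X_sym _ 3 4 _ 1 2) ?(X_sym _ 2 4 _ 1 3) ?(X_sym _ 2 3 _ 1 4);
  rewrite -[addb]/(@GRing.add bool); ring.

Lemma independent_parity_exchange :
  independent_parity
    false false false false false false false false false false =
  independent_parity true true true true true true true true true true.
Proof.
transitivity (independent_parity
    true false false false false false false false false false).
  by swap_step (@step 0 1 2 3 4 false false false isT isT isT).
transitivity (independent_parity
    true true false false false false false false false false).
  by swap_step (@step 0 2 1 3 4 false false false isT isT isT).
transitivity (independent_parity
    true true true false false false false false false false).
  by swap_step (@step 0 3 1 2 4 false false false isT isT isT).
transitivity (independent_parity
    true true true true false false false false false false).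
  by swap_step (@step 0 4 1 2 3 false false false isT isT isT).
transitivity (independent_parity
    true true true true true false false false false false).
  by swap_step (@step 1 2 0 3 4 true false true isT isT isT).
transitivity (independent_parity
    true true true true true true false false false false).
  by swap_step (@step 1 3 0 2 4 true false true isT isT isT).
transitivity (independent_parity
    true true true true true true true false false false).
  by swap_step (@step 1 4 0 2 3 true false true isT isT isT).
transitivity (independent_parity
    true true true true true true true true false false).
  by swap_step (@step 2 3 0 1 4 true true true isT isT isT).
transitivity (independent_parity
    true true true true true true true true true false).
  by swap_step (@step 2 4 0 1 3 true true true isT isT isT).
by swap_step (@step 3 4 0 1 2 true true true isT isT isT).
Qed.
End Exchange.

Section VanKampen.
Variables (R : realFieldType) (I : eqType) (p : I -> R * R) (D : pred I).
Hypothesis general_position : forall a b c, a \in D -> b \in D -> c \in D ->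
  uniq [:: a; b; c] -> orient (p a) (p b) (p c) != 0%R.
Variables (c : nat -> I) (P : nat -> nat -> seq I).
Hypothesis P_end : forall i j, i < j < 5 -> last (c i) (P i j) = c j.
Hypothesis P_in : forall i j, i < j < 5 -> all D (c i :: P i j).
Hypothesis P_disjoint : forall i j k l, i < j < 5 -> k < l < 5 ->
  uniq [:: i; j; k; l] -> all (fun z => z \notin c k :: P k l) (c i :: P i j).
Hypothesis c_uniq : uniq [:: c 0; c 1; c 2; c 3; c 4].

Let Q b i j := if b then [:: c j] else P i j.
Let X b i j b' k l := path_crossings p (c i) (Q b i j) (c k) (Q b' k l).

Let X_sym b i j b' k l : X b i j b' k l = X b' k l b i j.
Proof. exact: path_crossings_sym. Qed.

Let Q_end b i j : i < j < 5 -> last (c i) (Q b i j) = c j.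
Proof. by case: b => //= ij; exact: P_end. Qed.

Let Q_sub b i j : i < j < 5 -> {subset c i :: Q b i j <= c i :: P i j}.
Proof.
move=> ij z; case: b => //; rewrite !inE => /orP[->//|/eqP->].
by rewrite -(P_end ij) -in_cons mem_last.
Qed.

Let step i j k l m b1 b2 b3 : i < j < 5 -> [&& k < l, l < m & m < 5] ->
  uniq [:: i; j; k; l; m] ->
  X false i j b1 k l (+) X false i j b2 l m (+) X false i j b3 k m =
  X true i j b1 k l (+) X true i j b2 l m (+) X true i j b3 k m.
Proof.
move=> ij /and3P[kl lm m5] u.
have kl5 : k < l < 5 by lia.
have lm5 : l < m < 5 by lia.
have km5 : k < m < 5 by lia.
have [ukl ulm ukm] : [/\ uniq [:: i; j; k; l], uniq [:: i; j; l; m] & uniq [:: i; j; k; m]].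
  move: u; rewrite /= !inE => /and5P[u1 u2 u3 u4 _].
  by split; apply/and4P; split; lia.
have sub x : x \in c k :: Q b1 k l ++ Q b2 l m ++ Q b3 k m ->
    [|| x \in c k :: Q b1 k l, x \in c l :: Q b2 l m | x \in c k :: Q b3 k m].
  by rewrite !inE !mem_cat => /or4P[] ->; rewrite ?orbT.
have := @cycle_crossings_straighten R I p D general_position (c i) (P i j) (c k) (Q b1 k l) (Q b2 l m) (Q b3 k m).
rewrite last_cat !Q_end // P_end //; apply => //.
- exact: P_in.
- apply/allP => x /sub /or3P[] /Q_sub; [move/(_ kl5)|move/(_ lm5)|move/(_ km5)]; apply: (allP (P_in _)) => //.
- apply/allP => x xP; apply/negP => /sub /or3P[] /Q_sub xQ.
  + by have /negP := allP (P_disjoint ij kl5 ukl) x xP; apply; exact: xQ.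
  + by have /negP := allP (P_disjoint ij lm5 ulm) x xP; apply; exact: xQ.
  + by have /negP := allP (P_disjoint ij km5 ukm) x xP; apply; exact: xQ.
Qed.

(** Without crossings between independent edges the parity would be even; it is
    invariant under straightening all edges, and odd for straight edges. *)
Theorem van_kampen_K5 :
  ~ (forall i j k l, i < j < 5 -> k < l < 5 -> uniq [:: i; j; k; l] ->
     path_crossings p (c i) (P i j) (c k) (P k l) = false).
Proof.
move=> noX.
have := independent_parity_exchange X_sym step.
rewrite /independent_parity /X /Q !noX // => /esym.
have DD : all D [:: c 0; c 1; c 2; c 3; c 4].
  have Dc i j : i < j < 5 -> (c i \in D) && (c j \in D).
    move=> ij; have /allP Dij := P_in ij.
    by apply/andP; split; apply: Dij; rewrite ?mem_head // -(P_end ij) mem_last.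
  have /andP[D0 D1] := @Dc 0 1 isT; have /andP[D2 D3] := @Dc 2 3 isT.
  have /andP[_ D4] := @Dc 3 4 isT.
  by apply/and5P; split=> //=; rewrite andbT.
have [] := five_points general_position DD c_uniq.
by rewrite !path_crossings1 => -> _.
Qed.
End VanKampen.

(** * Perturbation into general position *)

Section Perturbation.
Variable R : realFieldType.
Local Open Scope ring_scope.

(** The numbers eps / k for k = 1, ..., size P are too many to be all roots. *)
Lemma small_nonroot (P : {poly R}) (eps : R) : P != 0 -> 0 < eps ->
  exists2 t, 0 < t <= eps & P.[t] != 0.
Proof.
move=> P0 eps0; pose f (k : nat) := eps / k.+1%:R.
have [/hasP[t tf Pt]|] := boolP (has (fun t => P.[t] != 0) [seq f k | k <- iota 0 (size P)]).
  exists t => //; move: tf => /mapP[k _ ->]; rewrite /f divr_gt0 //=.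
  by rewrite ler_pdivrMr // ler_peMr ?ler1n // ltW.
rewrite -all_predC => /allP allroot.
have fI : injective f.
  move=> j k /(mulfI (lt0r_neq0 eps0)) /invr_inj /eqP.
  by rewrite eqr_nat eqSS => /eqP.
have := @max_poly_roots _ P [seq f k | k <- iota 0 (size P)] P0.
rewrite size_map size_iota ltnn map_inj_uniq // iota_uniq => h.
suff: false by []. apply: h => //; apply/allP => t /allroot /=.
by rewrite negbK.
Qed.

(** Distance in the maximum norm, which is the one whose balls are the products
    of balls. *)
Definition close (eps : R) (x y : R * R) : bool :=
  (`|x.1 - y.1| < eps) && (`|x.2 - y.2| < eps).

Lemma close_sym eps x y : close eps x y = close eps y x.
Proof. by rewrite /close distrC [`|x.2 - _|]distrC. Qed.

Lemma close_refl eps x : 0 < eps -> close eps x x.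
Proof. by rewrite /close !subrr normr0 => ->. Qed.

Lemma close_trans e f x y z :
  close e x y -> close f y z -> close (e + f) x z.
Proof.
move=> /andP[x1 x2] /andP[y1 y2]; apply/andP; split.
  by rewrite (le_lt_trans (ler_distD y.1 _ _)) // ltrD.
by rewrite (le_lt_trans (ler_distD y.2 _ _)) // ltrD.
Qed.

(** Each point is moved by t times a point (n, n^2) of the parabola, with
    different n for different indices.  The orientation of a triple becomes a
    polynomial in t, with the orientation of three points of the parabola as
    coefficient of t^2; this is a nonzero Vandermonde determinant.  Hence the
    product of all these polynomials is nonzero at some small t. *)
Lemma general_position_perturbation (I : countType) (p : I -> R * R) (s : seq I)
    (eps : R) : 0 < eps ->
  exists p' : I -> R * R,
    {in s, forall i, close eps (p i) (p' i)} /\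
    {in s & &, forall a b c, uniq [:: a; b; c] ->
       orient (p' a) (p' b) (p' c) != 0}.
Proof.
move=> eps0; pose n (i : I) : R := (pickle i)%:R.
pose q i : R * R := (n i, n i ^+ 2).
pose p_ (t : R) i : R * R := ((p i).1 + t * n i, (p i).2 + t * n i ^+ 2).
pose o0 a b c := orient (p a) (p b) (p c).
pose o2 a b c := orient (q a) (q b) (q c).
(* The linear coefficient is what remains at t = 1. *)
pose o1 a b c := orient (p_ 1 a) (p_ 1 b) (p_ 1 c) - o0 a b c - o2 a b c.
pose pol a b c : {poly R} := (o0 a b c)%:P + o1 a b c *: 'X + o2 a b c *: 'X^2.
have polE a b c t : (pol a b c).[t] = orient (p_ t a) (p_ t b) (p_ t c).
  rewrite /pol /o1 /o2 /o0 !hornerE /p_ /q /orient /=; ring.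
have pol0 a b c : uniq [:: a; b; c] -> pol a b c != 0.
  rewrite /= !inE negb_or => /and3P[/andP[ab ac] bc _].
  have nI x y : x != y -> n x - n y != 0.
    by move=> xy; rewrite subr_eq0 eqr_nat; apply: contra xy => /eqP /(pcan_inj pickleK) ->.
  suff: o2 a b c != 0.
    apply: contra => /eqP /(congr1 (fun P : {poly R} => P`_2)).
    rewrite /pol !coefD coefC !coefZ coefX coefXn /= coef0 => /eqP.
    by rewrite mulr0 !add0r mulr1.
  have -> : o2 a b c = (n b - n a) * (n c - n a) * (n c - n b).
    by rewrite /o2 /orient /q /=; ring.
  by rewrite !mulf_neq0 // nI // eq_sym.
pose P := \prod_(a <- s) \prod_(b <- s) \prod_(c <- s | uniq [:: a; b; c]) pol a b c.
have P0 : P != 0.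
  rewrite prodf_seq_neq0; apply/allP => a _ /=.
  rewrite prodf_seq_neq0; apply/allP => b _ /=.
  rewrite prodf_seq_neq0; apply/allP => c _; apply/implyP; exact: pol0.
pose M := 1 + \sum_(i <- s) (n i + n i ^+ 2).
have n0 i : 0 <= n i by rewrite ler0n.
have term0 i : 0 <= n i + n i ^+ 2 by rewrite addr_ge0 ?sqr_ge0.
have M0 : 0 < M by rewrite ltr_pwDl ?ltr01 // sumr_ge0.
have [t /andP[t0 teps] Pt] := small_nonroot P0 (divr_gt0 eps0 M0).
have tM : t * M <= eps by rewrite -ler_pdivlMr.
exists (p_ t); split=> [i si|a b c sa sb sc u].
  have : n i + n i ^+ 2 < M.
    rewrite /M (big_rem i) //= addrA ltr_wpDr ?sumr_ge0 //.
    by rewrite -[ltLHS]add0r ltrD2r ltr01.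
  have := sqr_ge0 (n i); have := n0 i.
  rewrite /close /p_ /= => h1 h2 h3.
  by apply/andP; split; rewrite opprD addrA subrr sub0r normrN ger0_norm ?mulr_ge0 // ?(ltW t0) //;
    apply: lt_le_trans tM; rewrite ltr_pM2l //; lra.
rewrite -polE; apply: contra Pt => /eqP pt0.
rewrite /P horner_prod; apply/eqP; rewrite (big_rem a) //=.
rewrite horner_prod (big_rem b) //= horner_prod (big_rem c) //=.
by move: u => /= ->; rewrite pt0 !mul0r.
Qed.

(** The two segments have a common point, and it is close to a and to c. *)
Lemma crosses_close (I : eqType) (p : I -> R * R) e f a b c d :
  crosses p a b c d -> close e (p a) (p b) -> close f (p c) (p d) ->
  close (e + f) (p a) (p c).
Proof.
rewrite /crosses /ccw.
case: (p a) (p b) (p c) (p d) => [a1 a2] [b1 b2] [c1 c2] [d1 d2].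
rewrite /close /=; set u := orient _ _ _; set v := orient _ _ _.
set w := orient _ _ _; set z := orient _ _ _.
move=> /andP[uv wz].
have uv0 : u - v != 0 by apply: contra uv; rewrite subr_eq0 => /eqP ->.
have wz0 : w - z != 0 by apply: contra wz; rewrite subr_eq0 => /eqP ->.
pose s := w / (w - z); pose t := u / (u - v).
have in01 (x y : R) : ((0 < x) != (0 < y))%R -> x - y != 0 -> 0 <= x / (x - y) <= 1.
  case: (ltrP 0 x); case: (ltrP 0 y) => // y0 x0 _ xy.
    have xy0 : 0 < x - y by lra.
    by rewrite divr_ge0 ?(ltW x0) ?(ltW xy0) //= ler_pdivrMr //; lra.
  have xy0 : x - y < 0 by rewrite lt_neqAle xy; lra.
  by rewrite -mulrNN -invrN divr_ge0 ?ler_pdivrMr /=; lra.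
have s01 := in01 _ _ wz wz0; have t01 := in01 _ _ uv uv0.
rewrite -/s in s01; rewrite -/t in t01.
(* s and t are the parameters of the common point on the two segments. *)
have E1 : a1 - c1 = t * (d1 - c1) + s * (a1 - b1).
  by rewrite /s /t /u /v /w /z /orient /= in uv0 wz0 *; field; apply/andP.
have E2 : a2 - c2 = t * (d2 - c2) + s * (a2 - b2).
  by rewrite /s /t /u /v /w /z /orient /= in uv0 wz0 *; field; apply/andP.
have bound (x y r g : R) : 0 <= r <= 1 -> `|x - y| < g -> `|r * (x - y)| < g.
  move=> /andP[r0 r1]; apply: le_lt_trans.
  by rewrite normrM ger0_norm // ler_piMl.
move=> /andP[ab1 ab2] /andP[cd1 cd2].
rewrite E1 E2; apply/andP; split; rewrite addrC (le_lt_trans (ler_normD _ _)) //.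
  by rewrite ltrD // bound // distrC.
by rewrite ltrD // bound // distrC.
Qed.
End Perturbation.

(** * Chains of small steps joining five points *)

Section ChainsMeet.
Variable R : realFieldType.

Lemma path_crossings_eq0 (I : eqType) (p : I -> R * R) (r : rel I) x s y t :
  path r x s -> path r y t ->
  {in x :: s & y :: t, forall a c, forall b d,
     r a b -> r c d -> crosses p a b c d = false} ->
  path_crossings p x s y t = false.
Proof.
elim: s x => //= b s IH x /andP[rxb rs] rt H.
rewrite IH // => [|a c ain cin]; last by apply: H => //; rewrite inE ain orbT.
rewrite addbF; elim: t y rt H {IH} => //= d t IH y /andP[ryd rt] H.
rewrite H ?mem_head // IH // => a c ain cin; apply: H => //.
by rewrite inE cin orbT.
Qed.

(** The points of the chains become the corners of ten polygonal paths.  Moving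
    every point by less than eps makes steps shorter than 3 eps; a crossing then
    puts two moved points within 6 eps, hence the original ones within 8 eps. *)
Lemma K5_chains_meet (eps : R) (c : nat -> R * R) (L : nat -> nat -> seq (R * R)) :
  (0 < eps)%R ->
  (forall i j, i < j < 5 -> path (close eps) (c i) (L i j)) ->
  (forall i j, i < j < 5 -> last (c i) (L i j) = c j) ->
  ~ (forall i j k l, i < j < 5 -> k < l < 5 -> uniq [:: i; j; k; l] ->
     {in c i :: L i j & c k :: L k l, forall x y, ~~ close (eps *+ 8) x y}).
Proof.
move=> eps0 Lpath Lend Ldisj.
(* Each position in each chain gets its own index, even if the same point
   occurs repeatedly: the perturbation must be able to separate them. *)
pose I : countType := (nat + nat * nat * nat)%type.
pose p (i : I) := match i with inl i => c i | inr (i, j, r) => nth (c j) (L i j) r end.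
pose P i j : seq I := rcons [seq inr (i, j, r) | r <- iota 0 (size (L i j))] (inl j).
have map_P i j : [seq p z | z <- P i j] = rcons (L i j) (c j).
  rewrite map_rcons -map_comp /=; congr rcons.
  rewrite -[RHS](mkseq_nth (c j)); exact: eq_map.
have inP i j z : i < j < 5 -> z \in (inl i : I) :: P i j -> p z \in c i :: L i j.
  move=> ij /(map_f p) /=; rewrite map_P !inE mem_rcons inE.
  case/or3P=> [->//|/eqP->|->]; last by rewrite orbT.
  by rewrite -in_cons -(Lend i j ij) mem_last.
pose s : seq I := flatten [seq inl i :: P i j | i <- iota 0 5, j <- iota 0 5].
have [p' [p'close p'gen]] := general_position_perturbation p s eps0.
have Ps i j : i < j < 5 -> {subset (inl i : I) :: P i j <= s}.
  move=> ij z zP; apply/flattenP; exists ((inl i : I) :: P i j) => //.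
  by apply: (allpairs_f (fun i j => (inl i : I) :: P i j)); rewrite mem_iota; lia.
pose r : rel I := [rel a b | [&& a \in s, b \in s & close eps (p a) (p b)]].
have rP i j : i < j < 5 -> path r (inl i) (P i j).
  move=> ij; have : path (relpre p (close eps)) (inl i) (P i j).
    rewrite -path_map map_P rcons_path Lpath //= Lend //; exact: close_refl.
  have path_r (a : I) t : path (relpre p (close eps)) a t ->
      {subset a :: t <= s} -> path r a t.
    elim: t a => //= b t IH a /andP[ab bt] sub.
    rewrite IH // ?andbT => [|z zt]; last by apply: sub; rewrite inE zt orbT.
    by apply/and3P; split=> //; apply: sub; rewrite !inE eqxx ?orbT.
  by move/path_r; apply; exact: Ps.
have gen a b d : a \in (mem s : pred I) -> b \in (mem s : pred I) -> d \in (mem s : pred I) ->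
  uniq [:: a; b; d] -> orient (p' a) (p' b) (p' d) != 0%R by exact: p'gen.
apply: (@van_kampen_K5 R I p' (mem s) gen (fun i => inl i) P).
- by move=> i j ij; rewrite last_rcons.
- by move=> i j ij; apply/allP => z /(Ps i j ij).
- move=> i j k l ij kl u; have {}u : [&& i != k, i != l, j != k & j != l].
    by move: u; rewrite /= !inE; lia.
  apply/allP => z; rewrite /P !inE !mem_rcons !inE.
  case/or3P => [/eqP->|/eqP->|/mapP[x _ ->]]; apply/negP => /or3P[/eqP[]|/eqP[]|/mapP[y _ []]] //; lia.
- by [].
move=> i j k l ij kl u; apply: (path_crossings_eq0 (rP i j ij) (rP k l kl)).
move=> a d aP dP b f /and3P[as_ bs ab] /and3P[ds fs df].
apply: contraNF (Ldisj i j k l ij kl u _ _ (inP i j a ij aP) (inP k l d kl dP)) => X.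
have near x y : x \in s -> y \in s -> close eps (p x) (p y) -> close (eps + eps + eps)%R (p' x) (p' y).
  move=> xs ys xy; apply: close_trans (p'close y ys).
  by apply: close_trans xy; rewrite close_sym p'close.
have := crosses_close X (near _ _ as_ bs ab) (near _ _ ds fs df).
move=> /(close_trans (p'close a as_)) h.
have := p'close d ds; rewrite close_sym => /(close_trans h).
by congr (is_true (close _ _ _)); ring.
Qed.
End ChainsMeet.

(** * Connected and compact sets in the plane *)

Section Topology.
Variable R : realType.
Local Open Scope classical_set_scope.
Local Open Scope ring_scope.

Lemma ball_close (x y : R * R) (e : R) : ball x e y <-> close e x y.
Proof. by split=> [[? ?]|/andP[? ?]]; [apply/andP|]. Qed.

Definition chained (eps : R) (S : set (R * R)) (x y : R * R) : Prop :=
  exists s, [/\ path (close eps) x s, last x s = y & {in x :: s, forall z, S z}].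

Lemma chained_refl eps S x : S x -> chained eps S x x.
Proof. by move=> Sx; exists [::]; split=> // z; rewrite inE => /eqP ->. Qed.

Lemma chained_trans eps S x y z : chained eps S x y -> chained eps S y z -> chained eps S x z.
Proof.
move=> [s [ps ls Ss]] [t [pt lt St]]; exists (s ++ t); split.
- by rewrite cat_path ps ls.
- by rewrite last_cat ls.
move=> w; rewrite -cat_cons mem_cat => /orP[/Ss//|wt].
by apply: St; rewrite inE wt orbT.
Qed.

Lemma chained_sub eps S S' x y : S `<=` S' -> chained eps S x y -> chained eps S' x y.
Proof. by move=> SS' [s [ps ls Ss]]; exists s; split=> // z /Ss /SS'. Qed.

(** The points of S that can be reached from x form a subset that is open and
    closed in S. *)
Lemma connected_chained eps (S : set (R * R)) x y : 0 < eps -> connected S ->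
  S x -> S y -> chained eps S x y.
Proof.
move=> eps0 conn Sx Sy; pose B := [set z | S z /\ chained eps S x z].
have near_op (C : set (R * R)) : open (\bigcup_(b in C) ball b eps).
  by apply: bigcup_open => b _; exact: ball_open.
have extend z w : B z -> S w -> close eps z w -> B w.
  move=> [Sz xz] Sw zw; split=> //; apply: chained_trans xz _.
  exists [:: w]; split=> //=; first by rewrite zw.
  by move=> v; rewrite !inE => /orP[] /eqP ->.
suff BS : B = S by have [] : B y by rewrite BS.
apply: conn.
- by exists x; split=> //; exact: chained_refl.
- exists (\bigcup_(b in B) ball b eps) => //.
  apply/seteqP; split=> [z Bz|z [Sz [b Bb /ball_close bz]]].
    by split; [case: Bz|exists z => //; exact: ballxx].
  exact: extend bz.
exists (~` \bigcup_(b in S `\` B) ball b eps).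
  exact: open_closedC.
apply/seteqP; split=> [z Bz|z [Sz nz]].
  split; first by case: Bz.
  move=> [b [Sb nBb] /ball_close bz]; apply: nBb; apply: extend Bz Sb _.
  by rewrite close_sym.
by apply: contrapT => nBz; apply: nz; exists z => //; exact: ballxx.
Qed.

(** Stated with a filter, so that finitely many pairs of sets get a common
    distance. *)
Lemma compact_not_close (K L : set (R * R)) : compact K -> compact L ->
  K `&` L = set0 ->
  \forall d \near 0^'+, forall x y, K x -> L y -> ~~ close d x y.
Proof.
move=> cK cL KL0.
have /compact_near_coveringP/(_ R (0^'+) (fun d z => ~~ close d z.1 z.2)) := compact_setX cK cL.
move=> h; have {h} : \forall d \near 0^'+, K `*` L `<=` (fun z => ~~ close d z.1 z.2).
  apply: h => -[x y] [/= Kx Ly].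
  have [g g0 xyg] : exists2 g : R, 0 < g & ~~ close (g + g + g) x y.
    have xy : x != y.
      by apply/eqP => xy; have : (K `&` L) x by [split=> //; rewrite xy]; rewrite KL0.
    have : (0 < `|x.1 - y.1|) || (0 < `|x.2 - y.2|).
      rewrite !normr_gt0 !subr_eq0 -negb_and; apply: contra xy.
      by case: x y {Kx Ly} => [x1 x2] [y1 y2] /= /andP[/eqP-> /eqP->].
    case/orP=> pos; [exists (`|x.1 - y.1| / 3)|exists (`|x.2 - y.2| / 3)]; rewrite ?divr_gt0 //.
      by rewrite /close negb_and -!leNgt; apply/orP; left; lra.
    by rewrite /close negb_and -!leNgt; apply/orP; right; lra.
  exists (ball x g `*` ball y g, [set d | d < g]); first split.
  - exists (ball x g, ball y g); first by split; exact: nbhsx_ballx.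
    by [].
  - exact: nbhs_right_lt.
  move=> [[x' y'] d] /= [[/ball_close xx' /ball_close yy'] dg].
  apply: contra xyg => xy'.
  rewrite close_sym in yy'.
  have := close_trans (close_trans xx' xy') yy'.
  move=> /andP[h1 h2]; apply/andP; split; [apply: lt_trans h1 _|apply: lt_trans h2 _]; lra.
by apply: filterS => d h x y Kx Ly; exact: (h (x, y)).
Qed.
End Topology.

(** * A plane drawing has no K5 minor *)

Section Minor.
Variables (T : finType).
Implicit Types (e : rel T) (B V : {set T}).

Definition restrict e B : rel T := [rel x y | [&& x \in B, y \in B & e x y]].

Definition connected_in e B : Prop := {in B &, forall x y, connect (restrict e B) x y}.

(** The branch sets are B 0, ..., B 4; values of B beyond these are junk. *)
Definition K5_minor e V : Prop := exists B : nat -> {set T},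
  [/\ forall i, i < 5 -> [/\ B i \subset V, B i != finset.set0 & connected_in e (B i)],
      forall i j, i < j < 5 -> [disjoint B i & B j] &
      forall i j, i < j < 5 -> exists x y, [/\ x \in B i, y \in B j & e x y]].

Lemma restrict_sym e B : symmetric e -> symmetric (restrict e B).
Proof. by move=> e_sym x y; rewrite /restrict /= andbCA e_sym. Qed.

Lemma connect_restrictS e B B' x y : B \subset B' ->
  connect (restrict e B) x y -> connect (restrict e B') x y.
Proof.
move=> /fintype.subsetP BB'; apply: connect_sub => u v /and3P[uB vB uv].
by apply: connect1; rewrite /restrict /= !BB'.
Qed.
End Minor.

Section Drawing.
Variable R : realType.
Local Open Scope classical_set_scope.
Local Open Scope ring_scope.

Lemma arc_connected (A : set (R * R)) a b : is_arc A a b -> connected A.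
Proof.
move=> [g [gc _ _ _ ->]]; apply: connected_continuous_connected gc.
exact: segment_connected.
Qed.

Lemma arc_compact (A : set (R * R)) a b : is_arc A a b -> compact A.
Proof.
move=> [g [gc _ _ _ ->]]; apply: continuous_compact gc _.
exact: segment_compact.
Qed.

Lemma arc_ends (A : set (R * R)) a b : is_arc A a b -> A a /\ A b.
Proof.
move=> [g [_ _ <- <- ->]]; split; apply: imageP;
by rewrite /= in_itv /= lexx ler01.
Qed.

Variables (T : finType) (e : rel T) (p : T -> R * R) (A : {set T} -> set (R * R)).
Hypothesis e_irr : irreflexive e.
Hypothesis drawn : plane_drawing e p A.

Let linked : rel T := [rel x y | (x == y) || e x y].

(** What the drawing shows of a pair x, y of linked vertices; the case x = y
    makes the picture of a one-vertex set nonempty. *)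
Definition piece (x y : T) : set (R * R) :=
  if x == y then [set p x] else A [set x; y]%SET.

Definition picture (U : {set T}) : set (R * R) :=
  [set z | exists x y, [/\ x \in U, y \in U, linked x y & piece x y z]].

Lemma piece_compact x y : linked x y -> compact (piece x y).
Proof.
rewrite /linked /piece /=; case: eqP => [_ _|_ /= exy]; first exact: compact_set1.
by have [_ arcs _ _] := drawn; apply: arc_compact (arcs x y exy).
Qed.

Lemma vertex_on_piece x y z : linked x y -> piece x y (p z) -> z = x \/ z = y.
Proof.
have [p_inj _ nov _] := drawn.
rewrite /linked /piece /=; case: eqP => [_ _ /p_inj ->|_ /= exy Az]; first by left.
apply: contrapT => /not_orP[zx zy]; apply: (nov x y z exy).
by split=> // -[] /p_inj.
Qed.

(** A common point is not a vertex, as a vertex lies only on the pieces that it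
    belongs to; so it is an inner point of two different edges. *)
Lemma disjoint_pieces x y x' y' : linked x y -> linked x' y' ->
  [disjoint [set x; y]%SET & [set x'; y']%SET]%B ->
  piece x y `&` piece x' y' = set0.
Proof.
have [_ _ _ cross] := drawn.
move=> lxy lxy' dis; apply/seteqP; split=> // q [qxy qxy'].
have off z : z \in [set x; y]%SET -> q <> p z.
  move=> zxy qz; have := disjointFr dis zxy.
  by move: qxy'; rewrite qz => /(vertex_on_piece lxy') [] ->; rewrite !inE eqxx ?orbT.
have off' z : z \in [set x'; y']%SET -> q <> p z.
  move=> zxy qz; have := disjointFl dis zxy.
  by move: qxy; rewrite qz => /(vertex_on_piece lxy) [] ->; rewrite !inE eqxx ?orbT.
move: lxy lxy' qxy qxy'; rewrite /linked /piece /=.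
case: (eqVneq x y) => [_ _ _ qx|_ /= exy]; first by case: (off x); rewrite ?inE ?eqxx.
case: (eqVneq x' y') => [_ _ _ qx|_ /= exy' qxy qxy']; first by case: (off' x'); rewrite ?inE ?eqxx.
have : (arc_interior (A [set x; y]%SET) (p x) (p y) `&` A [set x'; y']%SET) q.
  by split=> //; split=> // -[]; apply: off; rewrite !inE eqxx ?orbT.
rewrite cross //.
  by rewrite inE; apply/existsP; exists x'; apply/existsP; exists y'; rewrite exy' eqxx.
apply/eqP => E; have := disjointFr dis (_ : x \in _).
by rewrite E !inE eqxx => /(_ isT).
Qed.

(** A walk in the graph is followed arc by arc. *)
Lemma picture_chained eps (U : {set T}) x y : 0 < eps -> x \in U ->
  connect (restrict e U) x y -> chained eps (picture U) (p x) (p y).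
Proof.
move=> eps0 xU /connectP[s + ->]; elim: s x xU => [|z s IH] x xU /=.
  move=> _; apply: chained_refl; exists x, x; split=> //; first by rewrite /linked /= eqxx.
  by rewrite /piece eqxx.
move=> /andP[/and3P[_ zU exz] ps].
apply: chained_trans (IH z zU ps).
have [_ arcs _ _] := drawn; have Axz := arcs x z exz.
have [Ax Az] := arc_ends Axz.
apply: chained_sub (connected_chained eps0 (arc_connected Axz) Ax Az).
move=> q Aq; exists x, z; split=> //; first by rewrite /linked /= exz orbT.
rewrite /piece ifF //; apply/eqP => xz; by rewrite xz e_irr in exz.
Qed.

(** Pictures consist of finitely many compact pieces. *)
Lemma pictures_apart : \forall d \near (0 : R)^'+, forall U W : {set T},
  [disjoint U & W]%B ->
  forall x y, picture U x -> picture W y -> ~~ close d x y.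
Proof.
pose ok (q : T * T * (T * T)) := [&& linked q.1.1 q.1.2, linked q.2.1 q.2.2 &
  [disjoint [set q.1.1; q.1.2]%SET & [set q.2.1; q.2.2]%SET]%B].
have : \forall d \near (0 : R)^'+, forall q, ok q ->
  forall x y, piece q.1.1 q.1.2 x -> piece q.2.1 q.2.2 y -> ~~ close d x y.
  apply: filter_forall => -[[x y] [x' y']].
  have [/and3P[/= h1 h2 h3]|_] := boolP (ok _); last by near=> d.
  have := compact_not_close (piece_compact h1) (piece_compact h2) (disjoint_pieces h1 h2 h3).
  by apply: filterS => d h _; exact: h.
apply: filterS => d h U W UW z w [x [y [xU yU xy zxy]]] [x' [y' [xW yW xy' wxy']]].
apply: (h ((x, y), (x', y'))) => //; apply/and3P; split=> //=.
apply: disjointWl (_ : _ \subset U) _; first by rewrite finset.subUset !finset.sub1set xU.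
by apply: disjointWr UW; rewrite finset.subUset !finset.sub1set xW.
Unshelve. all: by end_near.
Qed.

(** Two branch sets and the edge between them contain a walk joining chosen
    vertices v i and v j of theirs, and the pictures of disjoint pairs of branch
    sets are apart. *)
Lemma drawing_no_K5_minor V : symmetric e -> ~ K5_minor e V.
Proof.
move=> e_sym [B [Bin Bdis Badj]].
have [d [apart d0]] := filter_ex (filterI pictures_apart (nbhs_right_gt (0 : R))).
pose eps := d / 8.
have eps0 : 0 < eps by rewrite divr_gt0.
have dE : eps *+ 8 = d by rewrite /eps -mulr_natr divfK ?pnatr_eq0.
have /choice[v vP] : forall i, exists v, (i < 5)%N -> v \in B i.
  move=> i; case: (ltnP i 5) => [i5|_]; last first.
    by have [_ /finset.set0Pn[v _] _] := Bin 0 isT; exists v.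
  by have [_ /finset.set0Pn[v vB] _] := Bin i i5; exists v.
have conn i j : (i < j < 5)%N ->
    chained eps (picture (B i :|: B j)%SET) (p (v i)) (p (v j)).
  move=> ij; have [i5 j5] : (i < 5)%N /\ (j < 5)%N by lia.
  apply: picture_chained => //; first by rewrite inE vP.
  have [x [y [xB yB xy]]] := Badj i j ij.
  have [_ _ ci] := Bin i i5; have [_ _ cj] := Bin j j5.
  apply: connect_trans (connect_restrictS (finset.subsetUl _ _) (ci _ _ (vP i i5) xB)) _.
  apply: connect_trans (connect_restrictS (finset.subsetUr _ _) (cj _ _ yB (vP j j5))).
  by apply: connect1; rewrite /restrict /= !inE xB yB xy orbT.
have /choice[L LP] : forall ij : nat * nat, exists s, (ij.1 < ij.2 < 5)%N ->
    [/\ path (close eps) (p (v ij.1)) s, last (p (v ij.1)) s = p (v ij.2) &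
        {in p (v ij.1) :: s, forall z, picture (B ij.1 :|: B ij.2)%SET z}].
  move=> [i j] /=; have [/conn[s]|] := boolP (i < j < 5)%N; last by exists [::].
  by exists s.
apply: (@K5_chains_meet R eps (fun i => p (v i)) (fun i j => L (i, j)) eps0).
- by move=> i j /(LP (i, j))[].
- by move=> i j /(LP (i, j))[].
move=> i j k l ij kl u x y xL yL; rewrite dE.
have [_ _ /(_ x xL) px] := LP (i, j) ij; have [_ _ /(_ y yL) py] := LP (k, l) kl.
apply: apart px py.
have dis a b : (a < 5)%N -> (b < 5)%N -> a != b -> [disjoint B a & B b]%B.
  move=> a5 b5; case: (ltngtP a b) => // ab _; first by apply: Bdis; rewrite ab.
  by rewrite disjoint_sym; apply: Bdis; rewrite ab.
move: u; rewrite /= !inE => /and4P[u1 u2 u3 _].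
rewrite finset.disjoints_subset finset.subUset !finset.setCU !finset.subsetI -!finset.disjoints_subset.
by rewrite !dis //; lia.
Qed.
End Drawing.

(** * Dense graphs have a K5 minor *)

Section Dense.
Variables (T : finType).
Implicit Types (e : rel T) (V : {set T}).
Local Open Scope set_scope.

Definition neighbours e V x : {set T} := [set y in V | e x y].

(** Edges inside V are counted as ordered pairs, that is, twice. *)
Definition darts e V : {set T * T} := [set a | restrict e V a.1 a.2].

Lemma card_darts e V : #|darts e V| = \sum_(x in V) #|neighbours e V x|.
Proof.
rewrite -sum1_card (eq_bigl (fun a : T * T => (a.1 \in V) && ((a.2 \in V) && e a.1 a.2))).
  rewrite -(pair_big_dep (mem V) (fun x y => (y \in V) && e x y) (fun _ _ => 1)) /=.
  apply: eq_bigr => x xV; rewrite sum1_card; apply: eq_card => y.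
  by rewrite !inE.
by move=> a; rewrite inE.
Qed.

Lemma K5_minor_subrel e e' V : subrel e' e -> K5_minor e' V -> K5_minor e V.
Proof.
move=> ee' [B [Bin Bdis Badj]]; exists B; split=> // [i /Bin [BV B0 conn]|i j /Badj].
  split=> // x y xB yB; apply: connect_sub (conn x y xB yB) => a b /and3P[aB bB ab].
  by apply: connect1; rewrite /restrict /= aB bB ee'.
by move=> [x [y [xB yB /ee' xy]]]; exists x, y.
Qed.

Lemma K5_minorS e V V' : V' \subset V -> K5_minor e V' -> K5_minor e V.
Proof.
move=> VV' [B [Bin Bdis Badj]]; exists B; split=> // i /Bin [BV B0 conn].
by split=> //; apply: fintype.subset_trans VV'.
Qed.

Lemma connected_in1 e x : connected_in e [set x].
Proof. by move=> y z; rewrite !inE => /eqP -> /eqP ->; exact: connect0. Qed.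

Definition touch e : rel {set T} := fun B C =>
  [disjoint B & C] && [exists x in B, exists y in C, e x y].

Lemma touch1 e (B : {set T}) x y : x \in B -> y \notin B -> e x y ->
  touch e B [set y].
Proof.
move=> xB yB xy; rewrite /touch disjoint_sym disjoints1 yB /=.
apply/existsP; exists x; rewrite xB; apply/existsP; exists y.
by rewrite !inE eqxx.
Qed.

Lemma K5_minor_of_seq e V (s : seq {set T}) : size s = 5 ->
  {in s, forall B : {set T}, [/\ B \subset V, B != finset.set0 & connected_in e B]} ->
  pairwise (touch e) s -> K5_minor e V.
Proof.
move=> s5 sV /(pairwiseP finset.set0) st.
have stij i j : i < j < 5 ->
    touch e (nth finset.set0 s i) (nth finset.set0 s j).
  by move=> ij; apply: st; rewrite ?inE ?s5; lia.
exists (nth finset.set0 s); split=> [i i5|i j /stij /andP[]//|i j /stij /andP[_]].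
  by apply: sV; rewrite mem_nth ?s5.
by move=> /existsP[x /andP[xB /existsP[y /andP[yB xy]]]]; exists x, y.
Qed.

Lemma clique_K5_minor e V (s : seq T) : irreflexive e ->
  size s = 5 -> {subset s <= V} -> pairwise e s -> K5_minor e V.
Proof.
move=> e_irr s5 sV es.
apply: (@K5_minor_of_seq _ _ [seq [set x] | x <- s]); first by rewrite size_map.
  move=> _ /mapP[x /sV xV ->]; rewrite finset.sub1set; split=> //.
    by apply/finset.set0Pn; exists x; rewrite inE.
  exact: connected_in1.
rewrite pairwise_map; apply: sub_pairwise es => x y xy /=.
apply: (touch1 (x := x)); rewrite ?inE //.
by apply: contraTneq xy => ->; rewrite e_irr.
Qed.

(** Among v, a, b, c, d, f only the pairs ab and cd may be non-adjacent.
    Contracting the edge ac makes up for both: the contracted vertex is adjacent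
    to b through c and to d through a. *)
Lemma K6_minus_matching_K5_minor e V v a b c d f : symmetric e -> irreflexive e ->
  {subset [:: v; a; b; c; d; f] <= V} ->
  uniq [:: v; a; b; c; d; f] ->
  all (e v) [:: a; b; c; d; f] -> all (e f) [:: a; b; c; d] ->
  [&& e a c, e a d, e b c & e b d] -> K5_minor e V.
Proof.
move=> e_sym e_irr sV us /and5P[va vb vc vd /andP[vf _]] /and5P[fa fb fc fd _].
move=> /and4P[ac ad bc bd].
have ne x y : e x y -> x != y by apply: contraTneq => ->; rewrite e_irr.
have sy x y : e x y -> e y x by rewrite e_sym.
have ab : a != b by move: us; rewrite /= !inE !negb_or => /and3P[_ /andP[]].
have cd : c != d.
  by move: us; rewrite /= !inE !negb_or => /and5P[_ _ _ /andP[]].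
apply: (@K5_minor_of_seq _ _ [:: [set a; c]; [set b]; [set d]; [set f]; [set v]]) => //.
  have sub1 x : x \in [:: v; a; b; c; d; f] ->
      [/\ [set x] \subset V, [set x] != finset.set0 & connected_in e [set x]].
    move=> /sV xV; split; last exact: connected_in1; first by rewrite finset.sub1set.
    by apply/finset.set0Pn; exists x; rewrite inE.
  move=> B; rewrite !inE; do 4? [case/orP]; move/eqP->; try by apply: sub1; rewrite !inE eqxx ?orbT.
  split.
  + by rewrite finset.subUset !finset.sub1set !sV // !inE eqxx ?orbT.
  + by apply/finset.set0Pn; exists a; rewrite !inE eqxx.
  move=> x y; rewrite !inE => /orP[] /eqP -> /orP[] /eqP ->; rewrite ?connect0 //;
  apply: connect1; rewrite /restrict /= !inE !eqxx ?orbT //=.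
  by rewrite e_sym.
have t1 x y : e x y -> touch e [set x] [set y].
  by move=> xy; apply: (touch1 (x := x)); rewrite ?inE // eq_sym ne.
rewrite /= !t1 ?andbT; [|by auto ..].
apply/and4P; split.
- by apply: (touch1 (x := c)); rewrite ?inE ?eqxx ?orbT ?negb_or ?(eq_sym b) ?ab ?ne; auto.
- by apply: (touch1 (x := a)); rewrite ?inE ?eqxx ?orbT ?negb_or ?(eq_sym d) ?cd ?ne; auto.
- by apply: (touch1 (x := a)); rewrite ?inE ?eqxx ?orbT ?negb_or ?ne; auto.
- by apply: (touch1 (x := a)); rewrite ?inE ?eqxx ?orbT ?negb_or ?ne; auto.
Qed.

(** Contraction of the edge uv into u.  The vertex v stays in the type, and its
    edges are meant to be ignored, by working inside V minus v. *)
Definition contract e (u v : T) : rel T := [rel x y |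
  (x != y) && [|| e x y, (x == u) && e v y | (y == u) && e v x]].

Lemma contract_sym e u v : symmetric e -> symmetric (contract e u v).
Proof. by move=> e_sym x y; rewrite /contract /= eq_sym e_sym [X in _ || X]orbC. Qed.

Lemma contract_irr e u v : irreflexive (contract e u v).
Proof. by move=> x; rewrite /contract /= eqxx. Qed.

(** Adding v to the branch set that contains u, if there is one, undoes the
    contraction. *)
Lemma contract_K5_minor e V u v : symmetric e -> u \in V -> v \in V -> e u v ->
  K5_minor (contract e u v) (V :\ v) -> K5_minor e V.
Proof.
move=> e_sym uV vV uv [B [Bin Bdis Badj]].
pose C i := if u \in B i then v |: B i else B i.
have BC i x : x \in B i -> x \in C i by rewrite /C; case: ifP; rewrite ?inE => // _ ->; rewrite orbT.
have vC i : u \in B i -> v \in C i by rewrite /C => ->; rewrite !inE eqxx.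
have vB i : i < 5 -> v \notin B i.
  by move=> /Bin[/fintype.subsetP sub _ _]; apply/negP => /sub; rewrite !inE eqxx.
exists C; split=> [i i5|i j ij|i j ij].
- have [/fintype.subsetP BV /finset.set0Pn[z zB] conn] := Bin i i5.
  split; last 1 first.
  + have csym := sym_connect_sym (restrict_sym (C i) e_sym).
    have toB x : x \in C i -> exists2 y, y \in B i & connect (restrict e (C i)) x y.
      rewrite {1}/C; case: ifP => [uB|_ xB]; last by exists x.
      rewrite !inE => /orP[/eqP->|xB]; last by exists x.
      by exists u => //; apply: connect1; apply/and3P; split; rewrite ?vC ?BC // e_sym.
    move=> x y /toB[x' x'B xx'] /toB[y' y'B yy'].
    apply: connect_trans xx' _; rewrite csym; apply: connect_trans yy' _.
    apply: connect_sub (conn _ _ y'B x'B) => a b /and3P[aB bB /andP[_]].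
    case/or3P=> [ab|/andP[/eqP au vb]|/andP[/eqP bu va]].
    * by apply: connect1; apply/and3P; split; rewrite // BC.
    * have uB : u \in B i by rewrite -au.
      by apply: (@connect_trans _ _ v); apply: connect1; apply/and3P; split; rewrite ?vC ?BC ?au.
    have uB : u \in B i by rewrite -bu.
    by apply: (@connect_trans _ _ v); apply: connect1; apply/and3P; split; rewrite ?vC ?BC ?bu // e_sym.
  + apply/fintype.subsetP => x; rewrite /C; case: ifP => _.
      by rewrite finset.in_setU1 => /orP[/eqP->//|/BV]; rewrite !inE => /andP[].
    by move/BV; rewrite !inE => /andP[].
  by apply/finset.set0Pn; exists z; exact: BC.
- have dis := Bdis i j ij; have [i5 j5] : i < 5 /\ j < 5 by lia.
  rewrite /C; case: ifP => uBi; case: ifP => uBj //.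
  + by have := disjointFr dis uBi; rewrite uBj.
  + by rewrite finset.disjoints_subset finset.subUset finset.sub1set !inE vB //= -finset.disjoints_subset.
  + by rewrite disjoint_sym finset.disjoints_subset finset.subUset finset.sub1set !inE vB //= -finset.disjoints_subset disjoint_sym.
have [x [y [xB yB /andP[_]]]] := Badj i j ij.
case/or3P=> [xy|/andP[/eqP xu vy]|/andP[/eqP yu vx]].
- by exists x, y; split=> //; exact: BC.
- by exists v, y; split=> //; [apply: vC; rewrite -xu|exact: BC].
- by exists x, v; split; [exact: BC|apply: vC; rewrite -yu|rewrite e_sym].
Qed.

Lemma card_darts_remove e V v : symmetric e ->
  #|darts e V| <= #|darts e (V :\ v)| + 2 * #|neighbours e V v|.
Proof.
move=> e_sym.
pose F := [set (v, y) | y in neighbours e V v].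
pose G := [set (y, v) | y in neighbours e V v].
have sub : darts e V \subset darts e (V :\ v) :|: F :|: G.
  apply/fintype.subsetP => -[x y]; rewrite !inE /= => /and3P[xV yV xy].
  have [xv|/= xv] := eqVneq x v.
    apply/orP; left; apply/orP; right; apply/imsetP; exists y; last by rewrite xv.
    by rewrite !inE yV -xv.
  have [yv|yv] := eqVneq y v; last by rewrite /restrict /= !inE xv yv xV yV xy.
  apply/orP; right; apply/imsetP; exists x; last by rewrite yv.
  by rewrite !inE xV e_sym -yv.
apply: leq_trans (subset_leq_card sub) _.
apply: leq_trans (leq_card_setU _ _) _.
have [cF cG] : #|F| <= #|neighbours e V v| /\ #|G| <= #|neighbours e V v|.
  by split; exact: leq_imset_card.
have := (leq_card_setU (darts e (V :\ v)) F).1; move: cF cG.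
move: #|F| #|G| #|_ :|: F| #|neighbours e V v| #|darts e _| => f g h n m; lia.
Qed.

(** The contraction gives u a new edge to every neighbour of v that was not yet
    one of u; both orientations of such an edge are counted. *)
Lemma card_darts_contract e V u v : symmetric e -> irreflexive e ->
  u \in V -> v \in V -> e u v ->
  let N := neighbours e V v in
  #|darts e (V :\ v)| + 2 * #|N :\ u :\: neighbours e V u|
    <= #|darts (contract e u v) (V :\ v)|.
Proof.
move=> e_sym e_irr uV vV uv; cbv zeta; set Z := neighbours e V v :\ u :\: _.
pose F := [set (u, y) | y in Z].
pose G := [set (y, u) | y in Z].
have ZP y : y \in Z -> [/\ y \in V, y != v, y != u, e v y & ~~ e u y].
  rewrite !inE => /andP[+ /and3P[yu yV vy]]; rewrite yV => uy; split=> //.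
  by apply: contraTneq vy => ->; rewrite e_irr.
have uv_ne : u != v by apply: contraTneq uv => ->; rewrite e_irr.
have sub : darts e (V :\ v) :|: F :|: G \subset darts (contract e u v) (V :\ v).
  apply/fintype.subsetP => -[x y]; rewrite !inE /= -orbA => /or3P[|/imsetP[z /ZP[zV zv zu vz _] [-> ->]]|/imsetP[z /ZP[zV zv zu vz _] [-> ->]]].
  - move=> /and3P[xV yV xy]; apply/and3P; split=> //; apply/andP; split.
      by apply: contraTneq xy => ->; rewrite e_irr.
    by rewrite xy.
  - apply/and3P; split; rewrite ?inE ?uv_ne ?uV ?zv ?zV //.
    by apply/andP; split; rewrite 1?eq_sym ?zu // eqxx vz orbT.
  apply/and3P; split; rewrite ?inE ?uv_ne ?uV ?zv ?zV //.
  by apply/andP; split; rewrite ?zu // eqxx vz !orbT.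
apply: leq_trans (subset_leq_card sub).
rewrite !cardsU.
have -> : (darts e (V :\ v) :|: F) :&: G = finset.set0.
  apply/finset.setP => -[x y]; rewrite !inE /=; apply/negP => /andP[/orP[h|h] /imsetP[z /ZP[_ _ zu _ uz] [zx zy]]].
    by move: h; rewrite zx zy => /and3P[_ _]; rewrite e_sym (negPf uz).
  by move: h => /imsetP[w _ [h _]]; rewrite -zx h eqxx in zu.
have -> : darts e (V :\ v) :&: F = finset.set0.
  apply/finset.setP => -[x y]; rewrite !inE /=; apply/negP => /andP[h /imsetP[z /ZP[_ _ zu _ uz] [zx zy]]].
  by move: h; rewrite zx zy => /and3P[_ _]; rewrite (negPf uz).
rewrite finset.cards0 !subn0 !card_imset; [lia|by move=> ? ? []..].
Qed.

Lemma card_non_neighbours e V v u : irreflexive e ->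
  let N := neighbours e V v in u \in N ->
  #|N :\ u :\: neighbours e V u| + #|N :&: neighbours e V u| + 1 = #|N|.
Proof.
move=> e_irr N uN; rewrite (cardsD1 u N) uN add1n addn1; congr _.+1.
rewrite -(cardsID (neighbours e V u) (N :\ u)) addnC; congr (_ + _).
apply: eq_card => x; rewrite !inE; have [->|//] := eqVneq x u.
by rewrite e_irr !andbF.
Qed.

(** Non-adjacent pairs inside N form a matching, by the last hypothesis.  If N
    is a clique, it has K4 as a subgraph and v completes it.  Otherwise let ab be
    a non-adjacent pair and c, d, f three further vertices of N.  They are
    adjacent to a and b and have at most one non-adjacent pair among them: either
    v, a, c, d, f is a clique or K6_minus_matching_K5_minor applies. *)
Lemma sparse_complement_K5_minor e V v (N : {set T}) :
  symmetric e -> irreflexive e -> v \in V -> N \subset V ->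
  {in N, forall x, e v x} -> 3 < #|N| ->
  (#|N| = 4 -> {in N &, forall x y, x != y -> e x y}) ->
  {in N & &, forall x y z, y != x -> z != x -> y != z -> e x y || e x z} ->
  K5_minor e V.
Proof.
move=> e_sym e_irr vV /fintype.subsetP NV vN N3 N4 two.
have v_notin : v \notin N by apply/negP => /vN; rewrite e_irr.
have [/existsP[a /existsP[b /and4P[aN bN ab nab]]]|cl] :=
  boolP [exists a, exists b, [&& a \in N, b \in N, a != b & ~~ e a b]]; last first.
  have sz : size (take 4 (enum N)) = 4 by rewrite size_takel // -cardE.
  have sub x : x \in take 4 (enum N) -> x \in N by move=> /mem_take; rewrite mem_enum.
  apply: (@clique_K5_minor e V (v :: take 4 (enum N))) => //.
  - by rewrite /= sz.
  - by move=> x; rewrite inE => /orP[/eqP->//|/sub /NV].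
  rewrite /=; apply/andP; split; first by apply/allP => x /sub /vN.
  have := take_uniq 4 (enum_uniq N); rewrite uniq_pairwise.
  apply: (sub_in_pairwise (P := mem N)); last by apply/allP => x /sub.
  move=> x y xN yN /= xy; move: cl; rewrite negb_exists => /forallP/(_ x).
  rewrite negb_exists => /forallP/(_ y).
  by rewrite negb_and xN negb_and yN negb_and xy /= negbK.
pose s := enum (N :\ a :\ b).
have sN x : x \in s -> [/\ x \in N, x != a, x != b, e a x & e b x].
  rewrite mem_enum finset.in_setD1 finset.in_setD1 => /and3P[xb xa xN]; split=> //.
    by have := two a b x aN bN xN; rewrite (negPf nab) /=; apply; rewrite // eq_sym.
  by have := two b a x bN aN xN; rewrite (e_sym b a) (negPf nab) /=; apply; rewrite // eq_sym.
have s_uniq : uniq s := enum_uniq _.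
have s_size : 2 < size s.
  rewrite -cardE; have := cardsD1 a N; have := cardsD1 b (N :\ a).
  rewrite aN finset.in_setD1 bN eq_sym ab /=.
  have : #|N| != 4 by apply/eqP => /N4 /(_ a b aN bN ab); rewrite (negPf nab).
  lia.
case: s sN s_uniq s_size => [|c [|d [|f t]]] //= sN s_uniq _.
have [cN ca cb ac bc] := sN c (mem_head _ _).
have [dN da db ad bd] : [/\ d \in N, d != a, d != b, e a d & e b d].
  by apply: sN; rewrite !inE eqxx orbT.
have [fN fa fb af bf] : [/\ f \in N, f != a, f != b, e a f & e b f].
  by apply: sN; rewrite !inE eqxx !orbT.
have [cd cf df] : [/\ c != d, c != f & d != f].
  by move: s_uniq; rewrite !inE !negb_or => /and3P[/and3P[-> -> _] /andP[-> _] _].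
(* The non-adjacent pair xy plays the role of cd, and z that of f. *)
have fallback x y z : x \in N -> y \in N -> z \in N -> x != y -> x != z -> y != z ->
    [/\ x != a, y != a & z != a] -> [/\ x != b, y != b & z != b] ->
    [/\ e a x, e a y & e a z] -> [/\ e b x, e b y & e b z] ->
    ~~ e x y -> K5_minor e V.
  move=> xN yN zN xy xz yz [xa ya za] [xb yb zb] [ax ay az] [bx by_ bz] nxy.
  have ezx : e z x.
    by have := two x y z xN yN zN; rewrite (negPf nxy) e_sym /=; apply; rewrite // eq_sym.
  have ezy : e z y.
    by have := two y x z yN xN zN; rewrite (e_sym y x) (negPf nxy) (e_sym y z) /=; apply; rewrite // eq_sym.
  apply: (@K6_minus_matching_K5_minor e V v a b x y z) => //.
  - by move=> w; rewrite !inE => /or4P[/eqP->//|/eqP->|/eqP->|/or3P[] /eqP->]; exact: NV.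
  - have vne w : w \in N -> v != w by apply: contraTneq => <-.
    by rewrite /= !inE !negb_or !vne // ab !(eq_sym a) !(eq_sym b) xa ya za xb yb zb xy xz yz.
  - by rewrite /= !vN.
  - by rewrite /= e_sym az e_sym bz ezx ezy.
  by rewrite ax ay bx by_.
have [ecd|ncd] := boolP (e c d); last exact: (fallback c d f).
have [ecf|ncf] := boolP (e c f); last by apply: (fallback c f d) => //; rewrite eq_sym.
have [edf|ndf] := boolP (e d f); last by apply: (fallback d f c) => //; rewrite eq_sym.
apply: (@clique_K5_minor e V [:: v; a; c; d; f]) => //.
  by move=> w; rewrite !inE => /or4P[/eqP->//|/eqP->|/eqP->|/orP[] /eqP->]; exact: NV.
by rewrite /= !vN // ac ad af ecd ecf edf.
Qed.

(** A vertex of N misses at most #|N| - 4 other vertices of N: none if #|N| = 4,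
    and at most one if #|N| = 5. *)
Lemma small_dense_neighbourhood e V v : symmetric e -> irreflexive e ->
  let N := neighbours e V v in v \in V -> 3 < #|N| <= 5 ->
  {in N, forall u, 2 < #|N :&: neighbours e V u|} -> K5_minor e V.
Proof.
move=> e_sym e_irr N vV cN dense.
have NP x : x \in N -> x \in V /\ e v x by rewrite inE => /andP.
have co u : u \in N -> #|N :\ u :\: neighbours e V u| + 4 <= #|N|.
  move=> uN; have := card_non_neighbours e_irr uN; have := dense u uN.
  by rewrite -/N; move: #|_ :\: _| #|_ :&: _| #|N|; lia.
have non x y : x \in N -> y \in N -> y != x -> ~~ e x y ->
    y \in N :\ x :\: neighbours e V x.
  move=> xN yN yx nxy; rewrite finset.in_setD finset.in_setD1 yx yN andbT.
  by rewrite inE (negPf nxy) andbF.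
apply: (@sparse_complement_K5_minor e V v N) => //.
- by apply/fintype.subsetP => x /NP[].
- by move=> x /NP[].
- by case/andP: cN.
- move=> N4 x y xN yN xy; apply: contraTT (co x xN) => nxy.
  have yNx := non x y xN yN _ nxy; rewrite eq_sym in yNx.
  by rewrite (cardsD1 y) yNx // N4; lia.
move=> x y z xN yN zN yx zx yz.
apply: contraTT (co x xN); rewrite negb_or => /andP[nxy nxz].
have /subset_leq_card : [set y; z] \subset N :\ x :\: neighbours e V x.
  by rewrite finset.subUset !finset.sub1set !non.
by rewrite cards2 yz; move: cN; move: #|_ :\: _| #|N|; lia.
Qed.

Lemma delete_edge_card_darts e V x y :
  #|darts e V| <= #|darts (delete_edge e [set x; y]) V| + 2.
Proof.
have sub : darts e V \subset darts (delete_edge e [set x; y]) V :|: [set (x, y); (y, x)].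
  apply/fintype.subsetP => -[a b]; rewrite !inE /= => /and3P[aV bV ab].
  have [/finset.setP E|nE] := eqVneq [set a; b] [set x; y]; last first.
    by apply/orP; left; apply/and3P; split=> //; apply/andP.
  apply/orP; right; move: (E a) (E b) (E x) (E y); rewrite !xpair_eqE !inE !eqxx !orbT /=.
  rewrite !(eq_sym x) !(eq_sym y).
  by case: (a == x); case: (a == y); case: (b == x); case: (b == y).
apply: leq_trans (subset_leq_card sub) _.
apply: leq_trans (leq_card_setU _ _) _.
by rewrite leq_add2l cards2; case: (_ != _).
Qed.

Lemma delete_edge_lt_darts e V x y : x \in V -> y \in V -> e x y ->
  #|darts (delete_edge e [set x; y]) V| < #|darts e V|.
Proof.
move=> xV yV xy; apply: proper_card; apply/properP; split.
  by apply/fintype.subsetP => -[a b]; rewrite !inE /= => /and3P[aV bV /andP[ab _]]; apply/and3P.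
exists (x, y); rewrite !inE /=; first by apply/and3P.
by rewrite /restrict /delete_edge /= eqxx !andbF.
Qed.

(** Induction on the number of vertices and, within it, on the number of edges.
    Deleting an edge keeps the hypothesis when there are at least 3n edges,
    deleting a vertex of degree at most 3 or contracting an edge in at most two
    triangles always does.  With fewer than 3n edges the average degree is below
    6, and v is a vertex of degree at most 5. *)
Theorem dense_K5_minor e V : symmetric e -> irreflexive e -> V != finset.set0 ->
  6 * #|V| <= #|darts e V| + 2 -> K5_minor e V.
Proof.
have [n] := ubnP #|V|; elim: n V e => // n IHn V e Vn.
have [m] := ubnP #|darts e V|; elim: m e => // m IHm e em e_sym e_irr V0 dense.
have [many|few] := leqP (6 * #|V|) #|darts e V|.
  have : 0 < #|darts e V| by apply: leq_trans many; rewrite muln_gt0 card_gt0 V0.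
  rewrite card_gt0 => /finset.set0Pn[[x y]]; rewrite inE /= => /and3P[xV yV xy].
  apply: (@K5_minor_subrel e (delete_edge e [set x; y])); first by move=> a b /andP[].
  have lt := delete_edge_lt_darts xV yV xy; have le := delete_edge_card_darts e V x y.
  apply: IHm => //; first by lia.
  - by move=> a b; rewrite /delete_edge /= e_sym finset.setUC.
  - by move=> a; rewrite /delete_edge /= e_irr.
  by lia.
have [v vV v5] : exists2 v, v \in V & #|neighbours e V v| <= 5.
  apply/exists_inP; apply: contraTT few => /exists_inPn big; rewrite -leqNgt.
  rewrite card_darts mulnC -sum_nat_const; apply: leq_sum => x xV.
  by have := big x xV; rewrite -ltnNge.
have card_Vv : #|V| = #|V :\ v|.+1 by rewrite (cardsD1 v) vV.
have remove := card_darts_remove V v e_sym.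
pose N := neighbours e V v; rewrite -/N in v5 remove.
have [N3|N3] := leqP #|N| 3.
  apply: (@K5_minorS e V (V :\ v)); first exact: subD1set.
  apply: IHn => //; [by lia| |by lia].
  have : #|N| <= #|V :\ v|.
    apply: subset_leq_card; apply/fintype.subsetP => x; rewrite !inE => /andP[-> vx].
    by rewrite andbT; apply: contraTneq vx => ->; rewrite e_irr.
  rewrite -card_gt0 => NV; rewrite lt0n; apply/eqP => Vv0.
  have : #|darts e (V :\ v)| = 0.
    move/eqP: Vv0; rewrite cards_eq0 => /eqP ->; apply/eqP; rewrite cards_eq0 -finset.subset0.
    by apply/fintype.subsetP => -[a b]; rewrite !inE /= => /and3P[]; rewrite inE.
  by lia.
have [dn|/existsP[u]] := boolP [forall u in N, 2 < #|N :&: neighbours e V u|].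
  apply: (@small_dense_neighbourhood e V v) => //; first by rewrite N3 v5.
  by move=> u uN; exact: (forall_inP dn).
rewrite negb_imply -leqNgt => /andP[uN few_common].
have [uV vu] : u \in V /\ e v u by move: uN; rewrite inE => /andP.
have uv : e u v by rewrite e_sym.
apply: (contract_K5_minor e_sym uV vV uv).
have := card_darts_contract e_sym e_irr uV vV uv.
have := card_non_neighbours e_irr uN.
rewrite /= -/N => card_N more.
apply: IHn; [by lia|exact: contract_sym|exact: contract_irr| |].
  apply/finset.set0Pn; exists u; rewrite !inE uV andbT.
  by apply: contraTneq vu => ->; rewrite e_irr.
move: card_N more few_common remove dense; rewrite card_Vv.
move: #|_ :\: neighbours _ _ _| #|_ :&: _| #|N| #|V :\ v| #|darts (contract _ _ _) _| #|darts e (_ :\ _)| #|darts e V|; lia.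
Qed.

End Dense.

(** * The sides of cut-edges *)

Section CutEdges.
Variables (T : finType) (e : rel T).
Hypotheses (e_sym : symmetric e) (e_irr : irreflexive e).
Local Open Scope set_scope.

(** The dart from y to x is the only one that leaves A. *)
Definition side (A : {set T}) (x y : T) : Prop :=
  [/\ e x y, x \notin A, y \in A &
      forall z w, z \in A -> e z w -> w \notin A -> z = y /\ w = x].

Lemma delete_edge_sym (E : {set T}) : symmetric (delete_edge e E).
Proof. by move=> x y; rewrite /delete_edge /= e_sym finset.setUC. Qed.

(** If the ends remained connected, deleting the edge would not change the
    connectivity relation, nor the number of components. *)
Lemma cut_edge_disconnects E : E \in cut_edges e ->
  exists x y, [/\ e x y, E = [set x; y] & ~~ connect (delete_edge e E) x y].
Proof.
rewrite !inE => /andP[/existsP[x /existsP[y /andP[xy /eqP EE]]] more].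
exists x, y; split=> //; apply: contraTN more => xy'; rewrite -leqNgt.
rewrite (@eq_n_comp _ e (delete_edge e E)) // => u v.
apply/idP/idP; apply: connect_sub => {u v} u v; last by move=> /andP[uv _]; exact: connect1.
move=> uv; have [uvE|uvE] := eqVneq [set u; v] E; last first.
  by apply: connect1; apply/andP.
have csym := sym_connect_sym (delete_edge_sym E).
have : u \in [set x; y] by rewrite -EE -uvE !inE eqxx.
have : v \in [set x; y] by rewrite -EE -uvE !inE eqxx orbT.
by rewrite !inE => /orP[] /eqP -> /orP[] /eqP ->; rewrite ?connect0 // csym.
Qed.

(** The ends a and b of another edge stay connected when E is deleted, so they
    are together separated from one of the ends of E, whose component is the side
    that is taken. *)
Lemma cut_edge_side E a b : E \in cut_edges e -> e a b -> [set a; b] != E ->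
  exists A x y, [/\ E = [set x; y], side A x y, a \notin A & b \notin A].
Proof.
move=> Ecut ab abE; set d := delete_edge e E.
have dsym := delete_edge_sym E; have csym := sym_connect_sym dsym.
have [x [y [xy EE xyd ya]]] : exists x y,
    [/\ e x y, E = [set x; y], ~~ connect d x y & ~~ connect d y a].
  have [x [y [xy EE xyd]]] := cut_edge_disconnects Ecut.
  have [ya|ya] := boolP (connect d y a); last by exists x, y.
  exists y, x; split; rewrite ?(csym y) 1?e_sym // 1?finset.setUC //.
  by apply: contra xyd => xa; apply: connect_trans xa _; rewrite csym.
exists [set z | connect d y z], x, y; split=> //; last 2 first.
- by rewrite inE.
- rewrite inE; apply: contra ya => yb; apply: connect_trans yb _.
  by rewrite csym; apply: connect1; apply/andP.
split=> //; [by rewrite inE csym|by rewrite inE connect0|].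
move=> z w; rewrite !inE => yz zw yw.
have zwE : [set z; w] = E.
  apply/eqP; apply: contraNT yw => zwE; apply: connect_trans yz _.
  by apply: connect1; apply/andP.
have : z \in E by rewrite -zwE !inE eqxx.
have : w \in E by rewrite -zwE !inE eqxx orbT.
rewrite EE !inE => /orP[] /eqP w_eq /orP[] /eqP z_eq //; subst z w.
- by rewrite csym yz in xyd.
- by rewrite csym yz in xyd.
by rewrite connect0 in yw.
Qed.

(** A walk can leave the intersection of A and B neither through y, which is not
    in B, nor through y', which is not in A; but the graph is connected and y' is
    outside the intersection. *)
Lemma sides_apart A B x y x' y' : (forall u v, connect e u v) ->
  side A x y -> side B x' y' ->
  x \notin B -> y \notin B -> x' \notin A -> y' \notin A ->
  [disjoint A & B] /\ {in A & B, forall u v, ~~ e u v}.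
Proof.
move=> conn [xy xA yA Aout] [xy' xB' yB' Bout] xB yB xA' yA'.
have dis : [disjoint A & B].
  rewrite -setI_eq0; apply/eqP/finset.setP => z; rewrite finset.in_setI finset.in_set0.
  apply/negP => zAB.
  have clo : fingraph.closed e (A :&: B).
    apply: intro_closed; first exact: sym_connect_sym.
    move=> u v uv; rewrite !finset.in_setI => /andP[uA uB].
    apply/andP; split; apply: contraT.
      by move=> vA; have [uy _] := Aout u v uA uv vA; rewrite uy (negPf yB) in uB.
    by move=> vB; have [uy _] := Bout u v uB uv vB; rewrite uy (negPf yA') in uA.
  have := closed_connect clo (conn z y').
  by rewrite !finset.in_setI zAB (negPf yA').
split=> // u v uA vB; apply/negP => uv.
have vA : v \notin A by rewrite (disjointFl dis vB).
by have [_ vx] := Aout u v uA uv vA; rewrite vx (negPf xB) in vB.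
Qed.

(** Only y has a neighbour outside A, and only one. *)
Lemma side_card_darts A x y : side A x y ->
  {in A, forall z, 6 <= degree e z} -> 6 * #|A| <= #|darts e A| + 1.
Proof.
move=> [xy xA yA Aout] deg6.
have nb z : z \in A -> 6 <= #|neighbours e A z| + (z == y).
  move=> zA; apply: leq_trans (deg6 z zA) _.
  have [->|zy] := eqVneq z y.
    have : [set w | e y w] \subset neighbours e A y :|: [set x].
      apply/fintype.subsetP => w; rewrite !inE => yw; rewrite yw andbT.
      have [//|wA] := boolP (w \in A).
      by have [_ ->] := Aout y w yA yw wA; rewrite eqxx.
    move=> /subset_leq_card le; rewrite /degree (leq_trans le) //.
    by rewrite (leq_trans (leq_card_setU _ _)) ?cards1.
  rewrite addn0; apply: subset_leq_card; apply/fintype.subsetP => w; rewrite !inE => zw.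
  rewrite zw andbT; apply: contraT => wA.
  by have [/eqP] := Aout z w zA zw wA; rewrite (negPf zy).
have : \sum_(z in A) 6 <= \sum_(z in A) (#|neighbours e A z| + (z == y)).
  exact: leq_sum.
rewrite sum_nat_const mulnC => /leq_trans; apply.
rewrite big_split /= -card_darts leq_add2l.
rewrite (bigD1 y) //= eqxx big1 // => z /andP[_ /negPf ->] //.
Qed.

Lemma bigminn_le (I : eqType) (s : seq I) (P : pred I) (F : I -> nat) n i :
  i \in s -> P i -> \big[minn/n]_(j <- s | P j) F j <= F i.
Proof.
elim: s => // j s IH; rewrite inE big_cons => /orP[/eqP <- ->|is_ Pi].
  exact: geq_minl.
by case: ifP => _; rewrite ?geq_min IH ?orbT.
Qed.

Lemma sigma2_le u v : u != v -> ~~ e u v -> sigma2 e <= degree e u + degree e v.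
Proof.
move=> uv nuv; apply: (@bigminn_le _ _ _ (fun q : T * T => degree e q.1 + degree e q.2) _ (u, v)).
  exact: mem_index_enum.
by rewrite /= uv.
Qed.

Lemma light_or_heavy (A : {set T}) (d : nat) :
  {in A, forall z, d <= degree e z} \/ exists2 z, z \in A & degree e z < d.
Proof.
have [/forall_inP|] := boolP [forall z in A, d <= degree e z]; first by left.
by rewrite negb_forall => /existsP[z]; rewrite negb_imply -ltnNge => /andP[]; right; exists z.
Qed.

End CutEdges.

Theorem theorem1p4 (R : realType) (T : finType) (e : rel T)
  (e_sym : symmetric e) (e_irr : irreflexive e)
  (e_conn : connected_graph e) (e_planar : planar R e)
  (e_ncomp : non_complete e) (e_sigma2 : 11 <= sigma2 e) :
  #|cut_edges e| <= 1.
Proof.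
have [p [A drawn]] := e_planar; have [_ conn] := e_conn.
have light B x y : side e B x y -> exists2 z, z \in B & degree e z <= 5.
  move=> sB; have [heavy|//] := light_or_heavy e B 6.
  case: (drawing_no_K5_minor (V := B) e_irr drawn e_sym).
  apply: dense_K5_minor => //.
    by apply/finset.set0Pn; exists y; case: sB.
  by rewrite (leq_trans (side_card_darts sB heavy)) // leq_add2l.
rewrite leqNgt; apply/negP => /card_gt1P[E [F [Ecut Fcut EF]]].
have [a [b [ab Fab _]]] := cut_edge_disconnects e_sym Fcut.
have FE : [set a; b]%SET != E by rewrite -Fab eq_sym.
have [B [x [y [Exy sB aB bB]]]] := cut_edge_side e_sym Ecut ab FE.
have xy : e x y by case: sB.
have EF' : [set x; y]%SET != F by rewrite -Exy.
have [C [x' [y' [Fxy sC xC yC]]]] := cut_edge_side e_sym Fcut xy EF'.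
have FB z : z \in F -> z \notin B by rewrite Fab !inE => /orP[] /eqP ->.
have xB' : x' \notin B by apply: FB; rewrite Fxy !inE eqxx.
have yB' : y' \notin B by apply: FB; rewrite Fxy !inE eqxx orbT.
have [dis apart] := sides_apart e_sym conn sB sC xC yC xB' yB'.
have [u uB u5] := light _ _ _ sB; have [v vC v5] := light _ _ _ sC.
have uv : u != v by apply: contraTneq vC => <-; rewrite (disjointFr dis uB).
have := leq_trans e_sigma2 (sigma2_le uv (apart u v uB vC)).
by rewrite leqNgt ltnS (leq_add u5 v5).
Qed.
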